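(* Suppose that assumptions AS.1, AS.2, AS.3 and AS.4 (stated in the context) hold for the SQN iteration described in the context. Let $\tilde D>0$ be a (problem-independent) constant, $D_f:=f(x_1)-f^{low}$, and $$C_1=\frac{4\sigma\bar{\kappa}^2D_f}{\underline{\kappa}^2\sqrt{\tilde D}}+\sigma L\sqrt{\tilde D},\qquad C_2=\frac{4L\bar{\kappa}^2D_f}{\underline{\kappa}^2}.$$ Let $\epsilon>0$ be a given accuracy tolerance, and let $\bar N$, the total number of oracle calls used to calculate the stochastic gradients $g_k$ in SQN, satisfy $$\bar N\ge\max\left\{\frac{C_1^2}{\epsilon^2}+\frac{4C_2}{\epsilon},\ \frac{\sigma^2}{L^2\tilde D}\right\}.$$ Let the batch sizes be $$m_k=m:=\left\lceil\min\left\{\bar N,\max\left\{1,\frac{\sigma}{L}\sqrt{\frac{\bar N}{\tilde D}}\right\}\right\}\right\rceil,$$ let the number of iterations be $N=\lceil\bar N/m\rceil$, let $\alpha_k=\underline{\kappa}/(L\bar{\kappa}^2)$ for all $k=1,\ldots,N$, and let $R$ be a random variable, independent of the samples, with probability mass function $$\mathrm{Prob}\{R=k\}=\frac{\alpha_k\underline{\kappa}-\alpha_k^2L\bar{\kappa}^2/2}{\sum_{j=1}^N\left(\alpha_j\underline{\kappa}-\alpha_j^2L\bar{\kappa}^2/2\right)},\qquad k=1,\ldots,N.$$ Then $\mathbb{E}[\|\nabla f(x_R)\|^2]\le\epsilon$, where the expectation is taken with respect to $R$ and $\xi_{[N]}$.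
   Context: Setting. $f(x)=\mathbb{E}[F(x,\xi)]$ for $x\in\mathbb{R}^n$, where $F:\mathbb{R}^n\times\mathbb{R}^d\to\mathbb{R}$ is continuously differentiable and possibly nonconvex and $\xi$ is a random vector in $\mathbb{R}^d$. A stochastic first-order oracle returns, for given $x$ and a sample $\xi$, a stochastic gradient $g(x,\xi)\in\mathbb{R}^n$ (each such evaluation is one oracle call); the distribution of $\xi$ is supported on a set $\Xi\subseteq\mathbb{R}^d$ not depending on $x$. $\|\cdot\|$ is the Euclidean norm, and $A\preceq B$ means $B-A$ is positive semidefinite. SQN (stochastic quasi-Newton) iteration. Given are $x_1\in\mathbb{R}^n$, a positive definite $H_1\in\mathbb{R}^{n\times n}$, batch sizes $m_k\ge 1$ and step sizes $\alpha_k>0$. At iteration $k=1,2,\ldots$: draw samples $\xi_k=(\xi_{k,1},\ldots,\xi_{k,m_k})$ and set $g_k=\frac1{m_k}\sum_{i=1}^{m_k}g(x_k,\xi_{k,i})$; generate a positive definite matrix $H_k$; set $x_{k+1}=x_k-\alpha_kH_kg_k$. Write $\xi_{[k]}=(\xi_1,\ldots,\xi_k)$. Assumptions. AS.1: $f:\mathbb{R}^n\to\mathbb{R}$ is continuously differentiable, $f(x)\ge f^{low}$ for all $x$ for some real $f^{low}$, and $\|\nabla f(x)-\nabla f(y)\|\le L\|x-y\|$ for all $x,y\in\mathbb{R}^n$. AS.2: all samples are independent, the samples of iteration $k$ are independent of $\{x_j\}_{j=1}^k$, and for each $k$ and each sample $\xi$ of iteration $k$ (expectation over that sample) $\mathbb{E}_{\xi}[g(x_k,\xi)]=\nabla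 f(x_k)$ and $\mathbb{E}_{\xi}[\|g(x_k,\xi)-\nabla f(x_k)\|^2]\le\sigma^2$, with $\sigma>0$. AS.3: there are positive constants $\underline{\kappa},\bar{\kappa}$ with $\underline{\kappa}I\preceq H_k\preceq\bar{\kappa}I$ for all $k$. AS.4: for every $k\ge2$, the random matrix $H_k$ depends only on $\xi_{[k-1]}$. *)

(* Defs.v *)
From HB Require Import structures.
From mathcomp Require Import all_boot all_order all_algebra.
From mathcomp Require Import all_classical all_reals all_analysis.

Set Implicit Arguments.
Unset Strict Implicit.
Unset Printing Implicit Defensive.

Import Order.TTheory GRing.Theory Num.Theory.
Import numFieldNormedType.Exports.

Local Open Scope classical_set_scope.
Local Open Scope ring_scope.

(* T equipped with its Borel sigma-algebra. *)
Notation borel T := (g_sigma_algebraType (@open T)).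

Section Euclidean.
Context {R : realType}.

(* The library norm `|v| on column vectors is the max norm. *)
Definition enorm n (v : 'cV[R]_n) : R := Num.sqrt (\sum_(i < n) v i 0 ^+ 2).

Definition psdmx n (A : 'M[R]_n) : Prop :=
  A^T = A /\ forall v : 'cV[R]_n, 0 <= (v^T *m A *m v) 0 0.

Definition pdmx n (A : 'M[R]_n) : Prop :=
  A^T = A /\ forall v : 'cV[R]_n, v != 0 -> 0 < (v^T *m A *m v) 0 0.

Definition loewner_le n (A B : 'M[R]_n) : Prop := psdmx (B - A).

(* Used for finite-dimensional V only, where continuity of all the directional
   derivatives is continuity of the differential in the operator norm. *)
Definition continuously_differentiable (V : normedModType R) (f : V -> R) :
    Prop :=
  (forall x, differentiable f x) /\ forall v, continuous (fun x => 'D_v f x).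

Definition gradient n (f : 'cV[R]_n -> R) (x : 'cV[R]_n) : 'cV[R]_n :=
  \col_i 'D_(delta_mx i 0) f x.

End Euclidean.

Section Independence.
Context {R : realType} {d : measure_display} {Omega : measurableType d}.
Variable P : probability Omega R.

Definition sigma_of d' (T : measurableType d') (X : Omega -> T) :
    set (set Omega) :=
  preimage_set_system setT X measurable.

Definition sigma_of_family (I : Type) d' (T : measurableType d') (D : set I)
    (X : I -> Omega -> T) : set (set Omega) :=
  <<s \bigcup_(i in D) sigma_of (X i) >>.

Definition independent (G1 G2 : set (set Omega)) : Prop :=
  forall A B, G1 A -> G2 B -> P (A `&` B) = (P A * P B)%E.

Definition mutually_independent (I : eqType) (D : set I)
    (G : I -> set (set Omega)) : Prop :=
  forall (s : seq I) (A : I -> set Omega), uniq s ->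
    (forall i, i \in s -> D i /\ G i (A i)) ->
    P (\bigcap_(i in [set` s]) A i) = (\prod_(i <- s) P (A i))%E.

End Independence.

(* mu is the law of xi. *)
Record expected_objective {R : realType} (n d : nat)
    (mu : probability (borel 'cV[R]_d) R) (Xi : set 'cV[R]_d)
    (F : 'cV[R]_n * 'cV[R]_d -> R) (f : 'cV[R]_n -> R) : Prop := {
  objective_C1 : continuously_differentiable F;
  (* as the left-hand side is finite, F (x, _) is mu-integrable *)
  objective_mean : forall x,
    (f x)%:E = (\int[mu]_z (F (x, z))%:E)%E;
  objective_support : {ae mu, forall z, Xi z}
}.

(* Iterations are numbered from 1 (values at index 0 are irrelevant), the
   samples of iteration k are xi k i for i = 0, ..., m k - 1. *)
Definition sample_index (m : nat -> nat) : set (nat * nat) :=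
  [set ki | (1 <= ki.1)%N /\ (ki.2 < m ki.1)%N].

Definition past_sample_index (m : nat -> nat) (k : nat) : set (nat * nat) :=
  [set ki | sample_index m ki /\ (ki.1 < k)%N].

Definition batch_gradient {R : realType} (n d : nat) {Omega : Type}
    (g : 'cV[R]_n -> 'cV[R]_d -> 'cV[R]_n) (m : nat -> nat)
    (xi : nat -> nat -> Omega -> 'cV[R]_d) (x : nat -> Omega -> 'cV[R]_n)
    (k : nat) (w : Omega) : 'cV[R]_n :=
  (m k)%:R^-1 *: \sum_(i < m k) g (x k w) (xi k i w).

Section SQN.
Context {R : realType} {disp : measure_display} {Omega : measurableType disp}.
Variables (P : probability Omega R) (n d : nat).
Implicit Types (g : 'cV[R]_n -> 'cV[R]_d -> 'cV[R]_n) (m : nat -> nat)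
  (xi : nat -> nat -> Omega -> 'cV[R]_d) (x : nat -> Omega -> 'cV[R]_n)
  (H : nat -> Omega -> 'M[R]_n) (f : 'cV[R]_n -> R).

(* The samples need not be identically distributed. *)
Record stochastic_oracle (Xi : set 'cV[R]_d) g m xi : Prop := {
  oracle_measurable : measurable_fun setT
    (fun p : (borel 'cV[R]_n * borel 'cV[R]_d)%type =>
       g p.1 p.2 : borel 'cV[R]_n);
  samples_measurable : forall ki, sample_index m ki ->
    measurable_fun setT (xi ki.1 ki.2 : Omega -> borel 'cV[R]_d);
  samples_support : forall ki, sample_index m ki ->
    {ae P, forall w, Xi (xi ki.1 ki.2 w)}
}.

Record sqn_iteration (x1 : 'cV[R]_n) (H1 : 'M[R]_n) (alpha : nat -> R)
    g m xi x H : Prop := {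
  sqn_H1_pd : pdmx H1;
  sqn_batch_ge1 : forall k, (1 <= k)%N -> (1 <= m k)%N;
  sqn_step_gt0 : forall k, (1 <= k)%N -> 0 < alpha k;
  sqn_x_init : forall w, x 1%N w = x1;
  sqn_H_init : forall w, H 1%N w = H1;
  sqn_H_pd : forall k, (1 <= k)%N -> {ae P, forall w, pdmx (H k w)};
  sqn_x_step : forall k w, (1 <= k)%N ->
    x k.+1 w = x k w - alpha k *: (H k w *m batch_gradient g m xi x k w)
}.

Record AS1 f (flow L : R) : Prop := {
  AS1_C1 : continuously_differentiable f;
  AS1_lower : forall y : 'cV[R]_n, flow <= f y;
  AS1_L_gt0 : 0 < L;
  AS1_lipschitz : forall y z : 'cV[R]_n,
    enorm (gradient f y - gradient f z) <= L * enorm (y - z)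
}.

(* In the last two fields the iterate x k w is frozen and the expectation runs
   over the sample only; the expectation of a vector is taken entrywise. *)
Record AS2 f g m xi x (sigma : R) : Prop := {
  AS2_samples_indep : mutually_independent P (sample_index m)
    (fun ki => sigma_of (xi ki.1 ki.2 : Omega -> borel 'cV[R]_d));
  AS2_iterates_indep : forall k, (1 <= k)%N ->
    independent P
      (sigma_of_family [set i | (i < m k)%N]
        (xi k : nat -> Omega -> borel 'cV[R]_d))
      (sigma_of_family [set j | (1 <= j <= k)%N]
        (x : nat -> Omega -> borel 'cV[R]_n));
  AS2_sigma_gt0 : 0 < sigma;
  AS2_unbiased : forall ki, sample_index m ki ->
    {ae P, forall w, forall j : 'I_n,
      'E_P[fun w' => (g (x ki.1 w) (xi ki.1 ki.2 w') j 0)%R]%E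
      = (gradient f (x ki.1 w) j 0)%:E};
  AS2_variance : forall ki, sample_index m ki ->
    {ae P, forall w,
      ('E_P[fun w' =>
         (enorm (g (x ki.1 w) (xi ki.1 ki.2 w') - gradient f (x ki.1 w))
            ^+ 2)%R]
       <= (sigma ^+ 2)%:E)%E}
}.

Record AS3 H (kl ku : R) : Prop := {
  AS3_kl_gt0 : 0 < kl;
  AS3_ku_gt0 : 0 < ku;
  AS3_bounds : forall k, (1 <= k)%N ->
    {ae P, forall w, loewner_le kl%:M (H k w) /\ loewner_le (H k w) ku%:M}
}.

(* H k is measurable with respect to the samples of iterations 1, ..., k-1. *)
Definition AS4 m xi H : Prop := forall k, (2 <= k)%N ->
  sigma_of (H k : Omega -> borel 'M[R]_n) `<=`
  sigma_of_family (past_sample_index m k)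
    (fun ki => xi ki.1 ki.2 : Omega -> borel 'cV[R]_d).

End SQN.

Section Constants.
Context {R : realType}.
Implicit Types sigma L kl ku Df Dt : R.

Definition C1 sigma L kl ku Df Dt : R :=
  4 * sigma * ku ^+ 2 * Df / (kl ^+ 2 * Num.sqrt Dt) + sigma * L * Num.sqrt Dt.

Definition C2 L kl ku Df : R := 4 * L * ku ^+ 2 * Df / kl ^+ 2.

(* The arguments of Num.ceil below are nonnegative, so that `|_|%N is the
   plain conversion from int to nat. *)
Definition batch_size sigma L Dt (Nbar : nat) : nat :=
  let s := Num.max 1 (sigma / L * Num.sqrt (Nbar%:R / Dt)) in
  `|Num.ceil (Num.min Nbar%:R s)|%N.

Definition num_iterations (Nbar m : nat) : nat :=
  `|Num.ceil ((Nbar%:R / m%:R)%R : R)|%N.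

Definition pmf_weight L kl ku (alpha : nat -> R) (k : nat) : R :=
  alpha k * kl - alpha k ^+ 2 * L * ku ^+ 2 / 2.

End Constants.

(* Main.v *)
(* The gradient being L-Lipschitz, one step satisfies
     f x_{k+1} <= f x_k + <grad f x_k, x_{k+1} - x_k>
                  + L/2 * |x_{k+1} - x_k|^2.
   Substituting g_k = grad f x_k + w_k, the bounds on H_k give
     f x_{k+1} + c * |grad f x_k|^2 <= f x_k + <v_k, w_k> + a * |w_k|^2
   where a = alpha^2 L ku^2 / 2, c = alpha kl - a, and v_k depends on x_k and
   H_k only.  As x_k and H_k are functions of the earlier samples, Fubini's
   theorem for the joint law of the past and one new sample shows that
   <v_k, w_k> and the products of the noises of two samples of a batch have
   mean zero, so that E |w_k|^2 <= sigma^2 / m.  For the prescribed step a = c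
   and R is uniform; telescoping yields
     E |grad f x_R|^2 <= 2 L ku^2 D_f / (kl^2 N) + sigma^2 / m,
   and the choice of m and N makes the right-hand side at most eps. *)

Require Import Defs.
From HB Require Import structures.
From mathcomp Require Import all_boot all_order all_algebra.
From mathcomp Require Import all_classical all_reals all_analysis.
From mathcomp Require Import measurable_realfun ring lra.

Set Implicit Arguments.
Unset Strict Implicit.
Unset Printing Implicit Defensive.

Import Order.TTheory GRing.Theory Num.Theory.
Import numFieldNormedType.Exports.

Local Open Scope classical_set_scope.
Local Open Scope ring_scope.

(** * Inner product, Euclidean norm and Loewner bounds *)

Section EuclideanSpace.
Context {R : realType} {n : nat}.
Implicit Types (u v w : 'cV[R]_n) (A B : 'M[R]_n).

Definition dotv u v : R := \sum_(i < n) u i 0 * v i 0.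

Lemma dotvE u v : dotv u v = (u^T *m v) 0 0.
Proof. by rewrite mxE; apply: eq_bigr => i _; rewrite mxE. Qed.

Lemma dotvC u v : dotv u v = dotv v u.
Proof. by apply: eq_bigr => i _; rewrite mulrC. Qed.

Lemma dotvDr u v w : dotv u (v + w) = dotv u v + dotv u w.
Proof. by rewrite !dotvE mulmxDr mxE. Qed.

Lemma dotvZr u a v : dotv u (a *: v) = a * dotv u v.
Proof. by rewrite !dotvE -scalemxAr mxE. Qed.

Lemma dotvDl u v w : dotv (u + v) w = dotv u w + dotv v w.
Proof. by rewrite dotvC dotvDr !(dotvC w). Qed.

Lemma dotvZl u a v : dotv (a *: u) v = a * dotv u v.
Proof. by rewrite dotvC dotvZr dotvC. Qed.

Lemma dotvNr u v : dotv u (- v) = - dotv u v.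
Proof. by rewrite -scaleN1r dotvZr mulN1r. Qed.

Lemma dotvBr u v w : dotv u (v - w) = dotv u v - dotv u w.
Proof. by rewrite dotvDr dotvNr. Qed.

Lemma dotv_mulmx A u v : dotv (A^T *m u) v = dotv u (A *m v).
Proof. by rewrite !dotvE trmx_mul trmxK mulmxA. Qed.

Lemma dotv_quadE A v : (v^T *m A *m v) 0 0 = dotv v (A *m v).
Proof. by rewrite dotvE mulmxA. Qed.

Lemma enorm2E v : enorm v ^+ 2 = \sum_(i < n) v i 0 ^+ 2.
Proof. by rewrite sqr_sqrtr// sumr_ge0// => i _; exact: sqr_ge0. Qed.

Lemma dotvv v : dotv v v = enorm v ^+ 2.
Proof. by rewrite enorm2E; apply: eq_bigr => i _; rewrite expr2. Qed.

Lemma enorm_ge0 v : 0 <= enorm v.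
Proof. exact: sqrtr_ge0. Qed.

Lemma sqr_coord_le_enorm2 v i : v i 0 ^+ 2 <= enorm v ^+ 2.
Proof.
rewrite enorm2E (bigD1 i)//= lerDl sumr_ge0// => j _; exact: sqr_ge0.
Qed.

Lemma enorm2D u v :
  enorm (u + v) ^+ 2 = enorm u ^+ 2 + 2 * dotv u v + enorm v ^+ 2.
Proof. by rewrite -!dotvv dotvDr !dotvDl (dotvC v u); ring. Qed.

Lemma enorm2Z a v : enorm (a *: v) ^+ 2 = a ^+ 2 * enorm v ^+ 2.
Proof. by rewrite -!dotvv dotvZr dotvZl; ring. Qed.

(** Let [a], [b], [c] be the values of the form at [(u, u)], [(u, v)], [(v, v)]. At [c u - b v] and
    [b u - a v] the quadratic form takes the nonnegative values [c (a c - b^2)] and [a (a c - b^2)].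
    This leaves the degenerate case [a = c = 0], where [u + v] and [u - v] force [b = 0]. *)
Lemma psdmx_cauchy_schwarz A u v : psdmx A ->
  dotv u (A *m v) ^+ 2 <= dotv u (A *m u) * dotv v (A *m v).
Proof.
move=> [symA posA].
have posq w : 0 <= dotv w (A *m w) by rewrite -dotv_quadE.
have symq : dotv v (A *m u) = dotv u (A *m v).
  by rewrite -[in LHS]symA dotvC dotv_mulmx.
have qD a b : dotv (a *: u + b *: v) (A *m (a *: u + b *: v)) =
    a ^+ 2 * dotv u (A *m u) + 2 * a * b * dotv u (A *m v)
    + b ^+ 2 * dotv v (A *m v).
  rewrite mulmxDr -!scalemxAr !dotvDr !dotvDl !dotvZr !dotvZl symq.
  by ring.
have q1 a b := posq (a *: u + b *: v).
have := q1 (dotv v (A *m v)) (- dotv u (A *m v)).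
have := q1 (dotv u (A *m v)) (- dotv u (A *m u)).
have := q1 1 1; have := q1 1 (- 1); have := posq u; have := posq v.
rewrite !qD.
set a := dotv u (A *m u); set b := dotv u (A *m v); set c := dotv v (A *m v).
move=> c0 a0 h1 h2 h3 h4.
have [a_gt0|a_le0] := ltP 0 a.
  by rewrite -subr_ge0 -(pmulr_rge0 _ a_gt0); lra.
have [c_gt0|c_le0] := ltP 0 c.
  by rewrite -subr_ge0 -(pmulr_rge0 _ c_gt0); lra.
have a00 : a = 0 by lra.
have c00 : c = 0 by lra.
have -> : b = 0 by move: h1 h2; rewrite a00 c00; lra.
by rewrite expr0n/= a00 mul0r.
Qed.

Lemma psdmx1 : psdmx (1%:M : 'M[R]_n).
Proof.
split; first exact: trmx1.
by move=> v; rewrite dotv_quadE mul1mx dotvv sqr_ge0.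
Qed.

Lemma dotv_le_enorm u v : dotv u v <= enorm u * enorm v.
Proof.
have := psdmx_cauchy_schwarz u v psdmx1; rewrite !mul1mx !dotvv -exprMn => h.
have [uv0|] := ltP 0 (dotv u v); last first.
  by move=> h0; apply: le_trans h0 _; rewrite mulr_ge0 ?enorm_ge0.
by rewrite -(ler_pXn2r (n := 2))// nnegrE ?mulr_ge0 ?enorm_ge0// ltW.
Qed.

Lemma loewner_scalar_ge A a v : loewner_le a%:M A ->
  a * enorm v ^+ 2 <= dotv v (A *m v).
Proof.
move=> [_ /(_ v)]; rewrite dotv_quadE mulmxBl dotvBr subr_ge0.
by rewrite mul_scalar_mx dotvZr dotvv.
Qed.

Lemma loewner_scalar_le A a v : loewner_le A a%:M ->
  dotv v (A *m v) <= a * enorm v ^+ 2.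
Proof.
move=> [_ /(_ v)]; rewrite dotv_quadE mulmxBl dotvBr subr_ge0.
by rewrite mul_scalar_mx dotvZr dotvv.
Qed.

(* Cauchy-Schwarz for the form of [A], applied to [v] and [A *m v], bounds
   [enorm (A *m v) ^+ 4] by [b ^+ 2 * enorm v ^+ 2 * enorm (A *m v) ^+ 2]. *)
Lemma loewner_enorm_le A a b v : 0 <= a -> 0 <= b ->
  loewner_le a%:M A -> loewner_le A b%:M ->
  enorm (A *m v) ^+ 2 <= b ^+ 2 * enorm v ^+ 2.
Proof.
move=> a0 b0 lA uA.
have psdA : psdmx A.
  split; last first.
    move=> w; rewrite dotv_quadE; apply: le_trans (loewner_scalar_ge w lA).
    by rewrite mulr_ge0 ?sqr_ge0.
  case: lA => + _; rewrite linearB/= tr_scalar_mx => /addIr.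
  exact.
have := psdmx_cauchy_schwarz (A *m v) v psdA; rewrite dotvv.
have := loewner_scalar_le v uA; have := loewner_scalar_le (A *m v) uA.
have := psdA.2 v; have := psdA.2 (A *m v); rewrite !dotv_quadE.
set p := dotv v _; set q := dotv _ (A *m (A *m v)).
set s := enorm v ^+ 2; set t := enorm (A *m v) ^+ 2.
move=> q0 p0 qb pb tt.
have t0 : 0 <= t by exact: sqr_ge0.
have [t_gt0|] := ltP 0 t; last first.
  by move/le_trans; apply; rewrite mulr_ge0 ?sqr_ge0.
rewrite -(ler_pM2l t_gt0) -expr2 (le_trans tt)//.
apply: le_trans (ler_pM q0 p0 qb pb) _.
by rewrite le_eqVlt; apply/orP; left; apply/eqP; ring.
Qed.

End EuclideanSpace.

(** * The descent lemma for a Lipschitz gradient *)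

Section Descent.
Context {R : realType} {n : nat}.
Implicit Types (f : 'cV[R]_n -> R) (a v y : 'cV[R]_n).

Lemma derive_gradient f a v : differentiable f a ->
  'D_v f a = dotv (gradient f a) v.
Proof.
move=> df; rewrite deriveE// [in LHS](matrix_sum_delta v) linear_sum/=.
apply: eq_bigr => i _; rewrite big_ord1 linearZ/= mxE deriveE//.
by rewrite mulrC.
Qed.

Lemma is_derive_line f a v t : differentiable f (a + t *: v) ->
  is_derive t (1 : R) (fun s => f (a + s *: v))
    (dotv (gradient f (a + t *: v)) v).
Proof.
move=> df.
(* The difference quotients along the line at [t] are those of [f] at [a + t v] in the direction
   [v]. *)
have E : (fun h : R => h^-1 *:
    (((fun s => f (a + s *: v)) \o shift t) (h *: (1 : R)) - f (a + t *: v))) =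
    (fun h : R => h^-1 *:
      ((f \o shift (a + t *: v)) (h *: v) - f (a + t *: v))).
  apply/funext => h /=; congr (_ *: (f _ - _)).
  by rewrite scalerDl /GRing.scale/= mulr1 addrCA.
apply: DeriveDef.
  rewrite /derivable [X in cvg (X @ _)]E; exact: (diff_derivable df).
by rewrite -derive_gradient// /derive [X in lim (X @ _)]E.
Qed.

(** The mean value theorem replaces integration along the segment. Subtracting [G t + K t^2] from
    [f (a + t v)] gives a function whose derivative at [c] in []0, 1[] is at most
    [L c |v|^2 - 2 K c = 0], by Cauchy-Schwarz and the Lipschitz bound. *)
Lemma lipschitz_gradient_descent f (L : R) a v : 0 <= L ->
  (forall y, differentiable f y) ->
  (forall y z, enorm (gradient f y - gradient f z) <= L * enorm (y - z)) ->
  f (a + v) <= f a + dotv (gradient f a) v + L / 2 * enorm v ^+ 2.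
Proof.
move=> L0 df lip.
pose K := L / 2 * enorm v ^+ 2; pose G := dotv (gradient f a) v.
pose p (t : R) := f (a + t *: v) - (G *: t + K *: (t * t)).
pose dp (t : R) := dotv (gradient f (a + t *: v)) v - (G + K * (t + t)).
have isd t : is_derive t (1 : R) p (dp t).
  apply: is_deriveB; first exact: is_derive_line.
  apply: is_deriveD.
    rewrite -[X in is_derive _ _ _ X](mulr1 G).
    exact: (@is_deriveZ _ _ _ id G t 1 1).
  have -> : K * (t + t) = K *: (t *: 1 + t *: 1 : R).
    by rewrite /GRing.scale/= mulr1.
  apply: (@is_deriveZ R R R (fun s : R => s * s) K t 1 (t *: 1 + t *: 1 : R)).
have [c] := @MVT R p dp 0 1 ltr01 (fun t _ => isd t)
  (derivable_within_continuous (fun t _ => @ex_derive _ _ _ _ _ _ _ (isd t))).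
rewrite in_itv/= => /andP[c0 c1]; rewrite subr0 mulr1 => E.
have dpc : dp c <= 0.
  have := le_trans (dotv_le_enorm (gradient f (a + c *: v) - gradient f a) v)
    (ler_wpM2r (enorm_ge0 v) (lip _ _)).
  rewrite addrAC subrr add0r dotvC dotvBr !(dotvC v) /dp.
  have -> : enorm (c *: v) = c * enorm v.
    apply: (@pexpIrn _ 2) => //; rewrite ?nnegrE ?mulr_ge0 ?enorm_ge0 ?ltW//.
    by rewrite exprMn enorm2Z.
  by rewrite -/G /K; lra.
have scaleM (b c' : R) : b *: c' = b * c' by [].
move: E dpc; rewrite /p scale1r scale0r addr0 !scaleM -/G -/K => <-.
lra.
Qed.

End Descent.

(** * Borel measurability of matrix-valued maps *)

Section BorelMeasurability.
Context {R : realType}.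

Lemma continuous_borel_measurable (T : ptopologicalType) (h : T -> R) :
  continuous h -> measurable_fun setT (h : borel T -> R).
Proof.
move=> /continuousP ch; apply: (measurability _ (RGenOpens.measurableE R)).
move=> _ [_ [a [b ->] <-]]; rewrite setTI; apply: sub_sigma_algebra.
exact/ch/interval_open.
Qed.

(** Density of the rationals gives a countable base of balls, so that Borel measurability of a
    matrix-valued map can be tested on balls. *)
Lemma open_bigcup_rat_ball m n (U : set 'M[R]_(m, n)) : open U ->
  U = \bigcup_(q in [set q : 'M[rat]_(m, n) * rat |
        ball (map_mx ratr q.1 : 'M[R]_(m, n)) (ratr q.2 : R) `<=` U])
      ball (map_mx ratr q.1 : 'M[R]_(m, n)) (ratr q.2 : R).
Proof.
move=> oU; apply/seteqP; split => [M UM|M [q /= + Mq]]; last exact.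
have : nbhs M U by exact: open_nbhs_nbhs.
rewrite -nbhs_ballE => -[_/posnumP[e] MU].
(* A ball of radius [r < e / 2] whose centre is within [r] of [M] contains [M] and stays within
   [2 r < e] of it. *)
have e2 : 0 < e%:num / 2 by [].
have [r] := rat_in_itvoo e2; rewrite in_itv/= => /andP[r0 re].
have H i j : exists q : rat, (ratr q : R) \in `]M i j - ratr r, M i j + ratr r[.
  have [|q] := @rat_in_itvoo R (M i j - ratr r) (M i j + ratr r);
    last by exists q.
  by rewrite ltrBlDr -addrA ltrDl addr_gt0.
exists (\matrix_(i, j) projT1 (cid (H i j)), r); last first.
  split=> // i j; rewrite !mxE; case: cid => q /=.
  rewrite in_itv/= => /andP[? ?]; rewrite /ball/= ltr_norml.
  by apply/andP; split; lra.
move=> N /= [_ qN]; apply: MU; split => // i j.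
have := qN i j; rewrite !mxE; case: cid => q /=.
rewrite in_itv/= => /andP[? ?]; rewrite /ball/= !ltr_norml => /andP[? ?].
by apply/andP; split; lra.
Qed.

Lemma measurable_mx d (T : measurableType d) m n (h : T -> borel 'M[R]_(m, n)) :
  (forall i j, measurable_fun setT (fun t => h t i j)) -> measurable_fun setT h.
Proof.
move=> mh; apply: (@measurability _ _ T (borel 'M[R]_(m, n)) setT h
  (@open 'M[R]_(m, n))) => //.
move=> _ [U oU <-].
rewrite setTI (open_bigcup_rat_ball oU) preimage_bigcup bigcup_mkcond.
apply: countable_bigcupT_measurable => // q; case: ifPn => // _.
(* A max-norm ball is a finite intersection of conditions on the entries. Positivity of the radius
   is a separate condition: a matrix without entries would not imply it. *)
rewrite [X in measurable X](_ : _ = [set t | 0 < ratr q.2 :> R] `&`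
    \bigcap_(ij in [set: 'I_m * 'I_n])
    ((fun t => h t ij.1 ij.2) @^-1` ball (ratr (q.1 ij.1 ij.2) : R) (ratr q.2))).
  apply: measurableI.
    have [q0|_] := ltP 0 (ratr q.2 : R).
      by rewrite [X in measurable X](_ : _ = setT)//; apply/seteqP; split.
    by rewrite [X in measurable X](_ : _ = set0)//; apply/seteqP; split.
  apply: fin_bigcap_measurable; first exact: finite_finset.
  move=> [i j] _; rewrite -[X in measurable X]setTI.
  by apply: mh => //; apply: open_measurable; exact: ball_open.
apply/seteqP; split => t /=.
  by case=> q0 hq; split => // -[i j] _ /=; have := hq i j; rewrite mxE.
by case=> q0 hq; split => // i j; rewrite mxE; exact: (hq (i, j)).
Qed.

Lemma measurable_coord m n i j :
  measurable_fun setT (fun M : borel 'M[R]_(m, n) => M i j).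
Proof.
exact: (continuous_borel_measurable (@coord_continuous R m n i j)).
Qed.

End BorelMeasurability.

(** * Independence of generated sigma-algebras, and Tonelli for independent maps *)

Section Independence.
Context {R : realType} {d : measure_display} {Omega : measurableType d}.
Variable P : probability Omega R.

Lemma sigma_of_measurable d' (T : measurableType d') (X : Omega -> T) :
  measurable_fun setT X -> sigma_of X `<=` measurable.
Proof. by move=> mX _ [B mB <-]; exact: mX. Qed.

(** Finite intersections of events of the single [sigma_of (X i)] form a pi-system [C] generating
    the left sigma-algebra. On [C] the finite measures [A => P (A & B)] and [A => P B * P A] agree
    by mutual independence, hence they agree on everything generated. *)
Lemma independent_family_l (I : eqType) d' (T : measurableType d')
    (D E : set I) (X : I -> Omega -> T) j :
  (forall i, D i -> measurable_fun setT (X i)) ->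
  mutually_independent P D (fun i => sigma_of (X i)) ->
  E `<=` D -> D j -> ~ E j ->
  independent P (sigma_of_family E X) (sigma_of (X j)).
Proof.
move=> mX ind ED Dj Ej A B EA XB.
have mB : measurable B by exact: (sigma_of_measurable (mX j Dj)).
pose C : set (set Omega) := [set A | exists s (F : I -> set Omega),
  [/\ uniq s, forall i, i \in s -> E i /\ sigma_of (X i) (F i)
    & A = \bigcap_(i in [set` s]) F i]].
have sigmaT i : sigma_of (X i) setT by exists setT => //; rewrite setTI.
have Cm : C `<=` measurable.
  move=> _ [s [F [_ sF ->]]]; apply: fin_bigcap_measurable => // i /sF[Ei].
  exact/sigma_of_measurable/mX/ED.
have CT : C setT.
  by exists [::], (fun=> setT); split => //; rewrite set_nil bigcap_set0.
have CI : setI_closed C.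
  move=> _ _ [s [F [us sF ->]]] [t [G [ut tG ->]]].
  (* The intersection of two such events is indexed by the union of both lists, with [setT] at an
     index that one list lacks. *)
  pose F' i :=
    (if i \in s then F i else setT) `&` (if i \in t then G i else setT).
  exists (undup (s ++ t)), F'; split; first exact: undup_uniq.
    move=> i; rewrite mem_undup mem_cat => ist; split.
      by case/orP : ist => [/sF[]|/tG[]].
    have [A1 mA1 eA1] : sigma_of (X i) (if i \in s then F i else setT).
      by case: ifPn => [/sF[]|_].
    have [A2 mA2 eA2] : sigma_of (X i) (if i \in t then G i else setT).
      by case: ifPn => [/tG[]|_].
    exists (A1 `&` A2); first exact: measurableI.
    by rewrite /F' -eA1 -eA2 !setTI.
  apply/seteqP; split => w.
    move=> [sw tw] i /=; rewrite mem_undup mem_cat => ist; split.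
      by case: ifPn => // /sw.
    by case: ifPn => // /tw.
  move=> stw; split => i /= it.
    have [|+ _] := stw i; first by rewrite /= mem_undup mem_cat it.
    by rewrite it.
  have [|_] := stw i; first by rewrite /= mem_undup mem_cat it orbT.
  by rewrite it.
have PBfin : P B \is a fin_num by rewrite fin_num_measure.
pose r : {nonneg R} := NngNum (fine_ge0 (measure_ge0 P B)).
suff : mrestr P mB A = mscale r P A.
  by rewrite /mrestr /mscale/= fineK// muleC.
apply: (@g_sigma_algebra_measure_unique _ _ _ C Cm (fun=> setT)) => //.
- by rewrite bigcup_const//; exists 0%N.
- move=> _ [s [F [us sF ->]]]; rewrite /= /mrestr /mscale/= fineK//.
  have js : j \notin s by apply/negP => /sF[].
  (* Mutual independence is used twice: for [j :: s], with [B] at the index [j], and for [s]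
     alone. *)
  pose F' i := if i == j then B else F i.
  have F'F i : i \in s -> F' i = F i.
    by rewrite /F' => si; case: eqP => // ij; rewrite -ij si in js.
  have F'j : F' j = B by rewrite /F' eqxx.
  have := ind (j :: s) F'; rewrite /= js us big_cons F'j.
  rewrite (eq_big_seq (fun i => P (F i))); last by move=> i si; rewrite F'F.
  rewrite -(ind s F) => //; last by move=> i /sF[Ei ?]; split => //; exact: ED.
  move=> <- //; last first.
    move=> i; rewrite inE => /predU1P[->|si]; first by rewrite /F' eqxx.
    by rewrite F'F//; have [Ei ?] := sF i si; split => //; exact: ED.
  congr (P _); apply/seteqP; split => w.
    move=> [sw Bw] i /=; rewrite inE => /predU1P[->|si].
      by rewrite /F' eqxx.
    by rewrite F'F//; exact: sw.
  move=> sw; split; last first.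
    by have := sw j; rewrite /F' eqxx; apply; exact: mem_head.
  by move=> i /= si; rewrite -F'F//; apply: sw; rewrite /= inE si orbT.
- by move=> _; rewrite /= /mrestr setTI ltey_eq PBfin.
- apply: smallest_sub EA; first exact: smallest_sigma_algebra.
  move=> F0 [i Ei XF]; apply: sub_sigma_algebra.
  exists [:: i], (fun=> F0); split => //.
    by move=> k; rewrite inE => /eqP ->.
  by rewrite set_cons1 bigcap_set1.
Qed.

(** Independence makes the law of [(X, Y)] the product of the two laws, and Tonelli integrates [Y]
    out first. The inner integral has [X w] frozen, which is the form in which [AS2] states its
    moments. *)
Lemma ge0_integral_independent d1 d2 (S : measurableType d1)
    (T : measurableType d2) (X : Omega -> S) (Y : Omega -> T)
    (psi : S * T -> \bar R) :
  measurable_fun setT X -> measurable_fun setT Y ->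
  independent P (sigma_of X) (sigma_of Y) ->
  measurable_fun setT psi -> (forall z, 0 <= psi z)%E ->
  (\int[P]_w psi (X w, Y w) = \int[P]_w \int[P]_w' psi (X w, Y w'))%E.
Proof.
move=> mX mY ind mpsi psi0.
pose X' : {mfun Omega >-> S} := HB.pack X (isMeasurableFun.Build _ _ _ _ X mX).
pose Y' : {mfun Omega >-> T} := HB.pack Y (isMeasurableFun.Build _ _ _ _ Y mY).
have mXY : measurable_fun setT (fun w => (X w, Y w)).
  exact: measurable_fun_pair.
pose XY' : {mfun Omega >-> (S * T)%type} :=
  HB.pack (fun w => (X w, Y w)) (isMeasurableFun.Build _ _ _ _ _ mXY).
transitivity (\int[distribution P X' \x distribution P Y']_z psi z)%E.
  transitivity (\int[distribution P XY']_z psi z)%E.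
    by rewrite ge0_integral_distribution.
  apply: eq_measure_integral => A mA _; apply/esym.
  apply: product_measure_unique => // A1 A2 mA1 mA2.
  rewrite /distribution /pushforward/=.
  rewrite -(ind (X @^-1` A1) (Y @^-1` A2)) //.
  - by exists A1 => //; rewrite setTI.
  - by exists A2 => //; rewrite setTI.
rewrite fubini_tonelli1// ge0_integral_distribution//; last 2 first.
- exact: measurable_fun_fubini_tonelli_F.
- by move=> x; exact: integral_ge0.
apply: eq_integral => w _ /=; rewrite /fubini_F ge0_integral_distribution//.
exact: measurableT_comp.
Qed.

End Independence.

(** * Products of mean zero under independence *)

Section CenteredProducts.
Context {R : realType} {d : measure_display} {Omega : measurableType d}.
Variable P : probability Omega R.
Implicit Types h u : Omega -> R.

Definition centered h :=
  P.-integrable setT (EFin \o h) /\ (\int[P]_w (h w)%:E = 0)%E.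

Definition square_integrable h :=
  measurable_fun setT h /\ (\int[P]_w (h w ^+ 2)%:E < +oo)%E.

Lemma centeredZ a h : centered h -> centered (fun w => a * h w).
Proof.
move=> [ih h0]; split; first exact: (integrableZl measurableT a ih).
by under eq_integral do rewrite EFinM; rewrite integralZl// h0 mule0.
Qed.

Lemma centeredD h u : centered h -> centered u -> centered (fun w => h w + u w).
Proof.
move=> [ih h0] [iu u0]; split; first exact: (integrableD measurableT ih iu).
by rewrite integralD_EFin// h0 u0 adde0.
Qed.

Lemma centered_sum (I : Type) (s : seq I) (p : pred I) (h : I -> Omega -> R) :
  (forall i, p i -> centered (h i)) ->
  centered (fun w => \sum_(i <- s | p i) h i w).
Proof.
move=> ch; elim: s => [|i s IH].
  under [X in centered X]funext do rewrite big_nil.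
  by split; [exact: integrable0|exact: integral0].
case: (boolP (p i)) => pi.
  under [X in centered X]funext do rewrite big_cons pi.
  by apply: centeredD => //; exact: ch.
by under [X in centered X]funext do rewrite big_cons (negbTE pi).
Qed.

(** Domination of [|h u|] by [h^2 + u^2]. *)
Lemma square_integrable_prod h u : square_integrable h -> square_integrable u ->
  P.-integrable setT (fun w => (h w * u w)%:E).
Proof.
move=> [mh h2] [mu u2].
have i2 v : square_integrable v -> P.-integrable setT (fun w => (v w ^+ 2)%:E).
  move=> [mv v2]; apply/integrableP; split.
    exact/measurable_EFinP/measurable_funX.
  by under eq_integral do rewrite gee0_abs ?lee_fin ?sqr_ge0//.
apply: (le_integrable measurableT _ _
  (integrableD measurableT (i2 h (conj mh h2)) (i2 u (conj mu u2)))).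
  exact/measurable_EFinP/measurable_funM.
move=> w _ /=; rewrite lee_fin normrM [leRHS]ger0_norm ?addr_ge0 ?sqr_ge0//.
rewrite -(real_normK (num_real (h w))) -(real_normK (num_real (u w))).
set a := `|h w|; set b := `|u w|.
by have := sqr_ge0 (a - b); have := sqr_ge0 a; have := sqr_ge0 b; nra.
Qed.

Section Independent.
Context d1 d2 (S : measurableType d1) (T : measurableType d2).
Variables (X : Omega -> S) (Y : Omega -> T).
Hypotheses (mX : measurable_fun setT X) (mY : measurable_fun setT Y).
Hypothesis ind : independent P (sigma_of X) (sigma_of Y).

Lemma measurable_partial_expectation (psi : S * T -> \bar R) :
  measurable_fun setT psi -> (forall z, 0 <= psi z)%E ->
  measurable_fun setT (fun w => \int[P]_w' psi (X w, Y w'))%E.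
Proof.
move=> mpsi psi0.
pose Y' : {mfun Omega >-> T} := HB.pack Y (isMeasurableFun.Build _ _ _ _ Y mY).
rewrite [X in measurable_fun _ X](_ : _ =
  fubini_F (distribution P Y') psi \o X); last first.
  apply/funext => w /=; rewrite /fubini_F ge0_integral_distribution//.
  exact: measurableT_comp.
by apply: measurableT_comp => //; exact: measurable_fun_fubini_tonelli_F.
Qed.

(** Tonelli applies to the positive and negative parts separately. A vanishing inner expectation
    makes their inner integrals equal for almost every [w], hence also the outer ones, which are
    finite by integrability and so cancel. *)
Lemma integral_independent_eq0 (psi : S * T -> R) :
  measurable_fun setT psi ->
  P.-integrable setT (fun w => (psi (X w, Y w))%:E) ->
  {ae P, forall w, \int[P]_w' (psi (X w, Y w'))%:E = 0}%E ->
  (\int[P]_w (psi (X w, Y w))%:E = 0)%E.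
Proof.
move=> mpsi ipsi psi0.
have mE : measurable_fun setT (EFin \o psi) by exact/measurable_EFinP.
pose psip : S * T -> \bar R := ((EFin \o psi)^\+)%E.
pose psin : S * T -> \bar R := ((EFin \o psi)^\-)%E.
have mp : measurable_fun setT psip by exact: measurable_funepos.
have mn : measurable_fun setT psin by exact: measurable_funeneg.
have p0 z : (0 <= psip z)%E by exact: funepos_ge0.
have n0 z : (0 <= psin z)%E by exact: funeneg_ge0.
have hp (h : Omega -> S * T) :
    ((fun w => (psi (h w))%:E)^\+ = (fun w => psip (h w)))%E.
  by apply/funext => w; rewrite /psip !funeposE.
have hn (h : Omega -> S * T) :
    ((fun w => (psi (h w))%:E)^\- = (fun w => psin (h w)))%E.
  by apply/funext => w; rewrite /psin !funenegE.
rewrite integralE.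
have ip := integral_funepos_lt_pinfty measurableT ipsi.
have -> : (\int[P]_w (fun w => (psi (X w, Y w))%:E)^\- w =
          \int[P]_w (fun w => (psi (X w, Y w))%:E)^\+ w)%E.
  transitivity (\int[P]_w psin (X w, Y w))%E; first by rewrite hn.
  transitivity (\int[P]_w psip (X w, Y w))%E; last by rewrite hp.
  rewrite !(ge0_integral_independent mX mY ind)//.
  apply: ge0_ae_eq_integral => //.
  - exact: measurable_partial_expectation.
  - exact: measurable_partial_expectation.
  - by move=> w _; exact: integral_ge0.
  - by move=> w _; exact: integral_ge0.
  apply: filterS psi0 => w + _; rewrite integralE hp hn.
  have : (0 <= \int[P]_w' psip (X w, Y w'))%E by exact: integral_ge0.
  have : (0 <= \int[P]_w' psin (X w, Y w'))%E by exact: integral_ge0.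
  (* Nonnegativity excludes [-oo], a finite and an infinite part cannot differ by 0, and two
     infinite parts are equal; only two finite values need an argument. *)
  case: (\int[P]_w' psip (X w, Y w'))%E => [a| |];
    case: (\int[P]_w' psin (X w, Y w'))%E => [b| |] //.
  by move=> _ _ /= /eqP; rewrite -EFinB eqe subr_eq0 => /eqP ->.
apply: subee; rewrite ge0_fin_numE//.
by apply: integral_ge0 => w _; exact: funepos_ge0.
Qed.

(** Once [X w] is frozen, [u (X w)] is a constant factor and leaves the inner integral. *)
Lemma centered_independent_prod (u : S -> R) (h : S * T -> R) :
  measurable_fun setT u -> measurable_fun setT h ->
  square_integrable (fun w => u (X w)) ->
  square_integrable (fun w => h (X w, Y w)) ->
  {ae P, forall w, P.-integrable setT (fun w' => (h (X w, Y w'))%:E) /\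
    \int[P]_w' (h (X w, Y w'))%:E = 0}%E ->
  centered (fun w => u (X w) * h (X w, Y w)).
Proof.
move=> mu mh u2 h2 h0.
have iuh := square_integrable_prod u2 h2.
split => //.
apply: (@integral_independent_eq0 (fun z => u z.1 * h z)) => //.
  apply: measurable_funM => //; exact: measurableT_comp.
apply: filterS h0 => w [ih h0]; under eq_integral do rewrite /= EFinM.
by rewrite integralZl// h0 mule0.
Qed.

End Independent.
End CenteredProducts.

(** * Adapted functions and comparison of integrals *)

(** Changing the sigma-algebra of the domain lets the closure properties of measurable functions
    apply verbatim to adapted ones. *)
Definition adapted d (Omega : measurableType d) (B : set (set Omega))
    d' (T : measurableType d') (X : Omega -> T) : Prop :=
  measurable_fun (setT : set (g_sigma_algebraType B)) X.

Lemma adaptedP d (Omega : measurableType d) (B : set (set Omega))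
    d' (T : measurableType d') (X : Omega -> T) :
  adapted B X <-> sigma_of X `<=` <<s B>>.
Proof.
split => [mX _ [A mA <-]|BX _ A mA]; first exact: mX.
by apply: BX; exists A.
Qed.

Lemma measurable_enorm2 {R : realType} n d (T : measurableType d)
    (h : T -> 'cV[R]_n) :
  (forall i, measurable_fun setT (fun t => h t i 0)) ->
  measurable_fun setT (fun t => enorm (h t) ^+ 2).
Proof.
move=> mh; under eq_fun do rewrite enorm2E.
by apply: measurable_sum => i; exact: measurable_funX.
Qed.

Lemma expectationE {R : realType} d (T : measurableType d)
    (P : probability T R) (X : T -> R) : ('E_P[X] = \int[P]_w (X w)%:E)%E.
Proof. by rewrite unlock. Qed.

(* No measurability is needed for the smaller function: the integral of a
   nonnegative function is a lower integral. *)
Lemma ge0_le_integralT {R : realType} d (T : measurableType d)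
    (mu : {measure set T -> \bar R}) (h r : T -> \bar R) :
  (forall t, 0 <= h t)%E -> (forall t, h t <= r t)%E ->
  (\int[mu]_t h t <= \int[mu]_t r t)%E.
Proof.
move=> h0 hr; rewrite !ge0_integralTE//; last first.
  by move=> t; exact: le_trans (h0 t) (hr t).
apply: le_ereal_sup => _ [s sh <-]; exists s => // t.
exact: le_trans (sh t) (hr t).
Qed.

(** Almost everywhere [r] is above a nonnegative function, so it agrees with its positive part
    there. The lemma serves upper bounds containing the signed cross terms of a step. *)
Lemma ae_le_integral_ge0 {R : realType} d (T : measurableType d)
    (mu : {measure set T -> \bar R}) (h r : T -> \bar R) :
  measurable_fun setT h -> (forall t, 0 <= h t)%E -> measurable_fun setT r ->
  {ae mu, forall t, h t <= r t}%E ->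
  (\int[mu]_t h t <= \int[mu]_t r t)%E.
Proof.
move=> mh h0 mr hr.
apply: (@le_trans _ _ (\int[mu]_t r^\+ t)%E).
  apply: ae_ge0_le_integral => //.
  - exact: measurable_funepos.
  by apply: filterS hr => t htr _; rewrite funeposE le_max htr.
rewrite le_eqVlt; apply/orP; left; apply/eqP; apply: ae_eq_integral => //.
  exact: measurable_funepos.
apply: filterS hr => t htr _; rewrite funeposE; apply/max_idPl.
exact: le_trans htr.
Qed.

(** * Deterministic estimates for one step *)

Lemma sqr_sum {R : comPzRingType} (I : finType) (a : I -> R) :
  (\sum_i a i) ^+ 2 = \sum_i a i ^+ 2 + \sum_i \sum_(j | j != i) a i * a j.
Proof.
rewrite expr2 mulr_suml -big_split; apply: eq_bigr => i _.
by rewrite mulr_sumr (bigD1 i)//= expr2.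
Qed.

(** The diagonal terms will carry the variance of a batch, the others will average out. *)
Lemma enorm2_sum {R : realType} n (I : finType) (v : I -> 'cV[R]_n) :
  enorm (\sum_i v i) ^+ 2 = \sum_i enorm (v i) ^+ 2 +
    \sum_l \sum_i \sum_(j | j != i) v i l 0 * v j l 0.
Proof.
under [X in _ = X + _]eq_bigr do rewrite enorm2E.
rewrite enorm2E exchange_big/= -big_split/=; apply: eq_bigr => l _.
by rewrite summxE sqr_sum.
Qed.

(** In the descent lemma the bound [ku] turns the quadratic term into [a |G + w|^2] and the bound
    [kl] controls [dotv G (A *m G)]. Everything linear in [w] is collected in one inner product;
    symmetry of [A] moves it from [w] to [G]. *)
Lemma quasi_newton_descent {R : realType} n (f : 'cV[R]_n -> R)
    (L kl ku s a : R) (A : 'M[R]_n) (y w : 'cV[R]_n) :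
  0 <= L -> 0 <= kl -> 0 <= ku -> 0 <= s ->
  (forall y, differentiable f y) ->
  (forall y z, enorm (gradient f y - gradient f z) <= L * enorm (y - z)) ->
  A^T = A -> loewner_le kl%:M A -> loewner_le A ku%:M ->
  a = s ^+ 2 * L * ku ^+ 2 / 2 ->
  f (y - s *: (A *m (gradient f y + w))) +
    (s * kl - a) * enorm (gradient f y) ^+ 2 <=
  f y + dotv ((2 * a) *: gradient f y - s *: (A *m gradient f y)) w
    + a * enorm w ^+ 2.
Proof.
move=> L0 kl0 ku0 s0 df lip symA lA uA aE; set G := gradient f y.
have := lipschitz_gradient_descent y (- (s *: (A *m (G + w)))) L0 df lip.
rewrite -/G dotvNr dotvZr -scaleNr enorm2Z sqrrN.
have -> : dotv G (A *m (G + w)) = dotv G (A *m G) + dotv (A *m G) w.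
  by rewrite mulmxDr dotvDr; congr (_ + _); rewrite -[in RHS]symA dotv_mulmx.
have -> : dotv ((2 * a) *: G - s *: (A *m G)) w =
    2 * a * dotv G w - s * dotv (A *m G) w.
  by rewrite dotvC dotvBr !dotvZr !(dotvC w).
have := ler_wpM2l s0 (loewner_scalar_ge G lA).
have ac : 0 <= L / 2 * s ^+ 2 by rewrite mulr_ge0 ?divr_ge0 ?sqr_ge0.
have := ler_wpM2l ac (loewner_enorm_le (G + w) kl0 ku0 lA uA).
by rewrite enorm2D aE; lra.
Qed.

(** A gradient step of length [1 / L] decreases [f] by at least [|grad f|^2 / (2 L)] and cannot go
    below [b]. *)
Lemma enorm2_gradient_le {R : realType} n (f : 'cV[R]_n -> R) (L b : R)
    (y : 'cV[R]_n) :
  0 < L -> (forall y, differentiable f y) ->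
  (forall y z, enorm (gradient f y - gradient f z) <= L * enorm (y - z)) ->
  (forall y, b <= f y) ->
  enorm (gradient f y) ^+ 2 <= 2 * L * (f y - b).
Proof.
move=> L0 df lip fb.
have := lipschitz_gradient_descent y ((- L^-1) *: gradient f y) (ltW L0) df lip.
move/(le_trans (fb _)).
rewrite dotvZr enorm2Z sqrrN dotvv mulNr.
have -> : L / 2 * (L^-1 ^+ 2 * enorm (gradient f y) ^+ 2) =
    L^-1 * enorm (gradient f y) ^+ 2 / 2 by field; rewrite gt_eqF.
move=> h; rewrite -(ler_pM2l (_ : 0 < L^-1 / 2)) ?divr_gt0 ?invr_gt0//.
have -> : L^-1 / 2 * (2 * L * (f y - b)) = f y - b by field; rewrite gt_eqF.
lra.
Qed.

(** * Adaptedness of the matrices, iterates and noises *)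

Section StochasticQuasiNewton.
Context {R : realType} {disp : measure_display} {Omega : measurableType disp}.
Variables (P : probability Omega R) (n d : nat).
Variables (f : 'cV[R]_n -> R) (g : 'cV[R]_n -> 'cV[R]_d -> 'cV[R]_n).
Variables (x1 : 'cV[R]_n) (H1 : 'M[R]_n) (m : nat -> nat) (alpha : nat -> R).
Variables (xi : nat -> nat -> Omega -> 'cV[R]_d) (x : nat -> Omega -> 'cV[R]_n).
Variables (H : nat -> Omega -> 'M[R]_n) (Xi : set 'cV[R]_d).
Variables (flow L sigma kl ku : R).
Hypotheses (hg : stochastic_oracle P Xi g m xi)
  (hSQN : sqn_iteration P x1 H1 alpha g m xi x H)
  (hAS1 : AS1 f flow L) (hAS2 : AS2 P f g m xi x sigma)
  (hAS3 : AS3 P H kl ku) (hAS4 : AS4 m xi H).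

(** Only a generating family, closed up by [adapted]. The index set is arbitrary because products of
    noises need the past together with one sample of the current batch. *)
Definition history (E : set (nat * nat)) : set (set Omega) :=
  \bigcup_(ki in E) sigma_of (xi ki.1 ki.2 : Omega -> borel 'cV[R]_d).

Definition noise k i (w : Omega) : 'cV[R]_n :=
  g (x k w) (xi k i w) - gradient f (x k w).

Lemma history_measurable E : E `<=` sample_index m ->
  <<s history E >> `<=` measurable.
Proof.
move=> Em; apply: smallest_sub; first exact: sigma_algebra_measurable.
move=> A [ki Eki]; apply: sigma_of_measurable; apply: (samples_measurable hg).
exact: Em.
Qed.

Lemma adapted_measurable E d' (T : measurableType d') (X : Omega -> T) :
  E `<=` sample_index m -> adapted (history E) X -> measurable_fun setT X.
Proof.
by move=> Em aX _ A mA; apply: (history_measurable Em); exact: aX.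
Qed.

Lemma sample_adapted (E : set (nat * nat)) k i : E (k, i) ->
  adapted (history E) (xi k i : Omega -> borel 'cV[R]_d).
Proof.
move=> Eki; apply/adaptedP => A XA; apply: sub_sigma_algebra.
by exists (k, i).
Qed.

Lemma qn_matrix_adapted E k : (1 <= k)%N -> past_sample_index m k `<=` E ->
  adapted (history E) (H k : Omega -> borel 'M[R]_n).
Proof.
case: k => [//|[_ _|k _ kE]].
  rewrite (_ : H 1%N = cst H1); first exact: measurable_cst.
  by apply/funext => w; rewrite (sqn_H_init hSQN).
apply/adaptedP; apply: subset_trans (hAS4 (k := k.+2) _) _ => //.
apply: smallest_sub; first exact: smallest_sigma_algebra.
by move=> A [ki /kE Eki XA]; apply: sub_sigma_algebra; exists ki.
Qed.

Lemma oracle_adapted B k i j :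
  adapted B (x k : Omega -> borel 'cV[R]_n) ->
  adapted B (xi k i : Omega -> borel 'cV[R]_d) ->
  adapted B (fun w => g (x k w) (xi k i w) j 0).
Proof.
move=> ax axi.
apply: (measurableT_comp (measurable_coord j 0)
  (measurableT_comp (oracle_measurable hg) (measurable_fun_pair ax axi))).
Qed.

(** Induction on the recursion: the new iterate is a measurable function of the previous iterate,
    its matrix and its batch, all of which are determined by samples indexed in [E]. *)
Lemma iterate_adapted E k : (1 <= k)%N -> past_sample_index m k `<=` E ->
  adapted (history E) (x k : Omega -> borel 'cV[R]_n).
Proof.
case: k => // k _; elim: k => [_|k IH kE].
  rewrite (_ : x 1%N = cst x1); first exact: measurable_cst.
  by apply/funext => w; rewrite (sqn_x_init hSQN).
have {}IH : adapted (history E) (x k.+1 : Omega -> borel 'cV[R]_n).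
  by apply: IH => ki [? ki1]; apply: kE; split => //; exact: ltnW.
have aH : adapted (history E) (H k.+1 : Omega -> borel 'M[R]_n).
  apply: qn_matrix_adapted => // ki [? ki1]; apply: kE.
  by split => //; exact: ltnW.
apply: measurable_mx => i j; rewrite ord1.
rewrite (_ : (fun _ => _) = (fun w => x k.+1 w i 0 - alpha k.+1 *
    \sum_l (H k.+1 w i l * ((m k.+1)%:R^-1 *
       \sum_(t < m k.+1) g (x k.+1 w) (xi k.+1 t w) l 0)))); last first.
  apply/funext => w; rewrite (sqn_x_step hSQN)// !mxE; congr (_ - _ * _).
  by apply: eq_bigr => l _; rewrite mxE summxE.
apply: measurable_funB.
  exact: (measurableT_comp (measurable_coord _ _) IH).
apply: measurable_funM; first exact: measurable_cst.
apply: measurable_sum => l; apply: measurable_funM.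
  exact: (measurableT_comp (measurable_coord _ _) aH).
apply: measurable_funM; first exact: measurable_cst.
apply: measurable_sum => t; apply: oracle_adapted => //.
apply: sample_adapted; apply: kE; split => //; split => //; exact: ltn_ord.
Qed.

Lemma measurable_gradient_coord j :
  measurable_fun setT (fun y : borel 'cV[R]_n => gradient f y j 0).
Proof.
rewrite (_ : (fun _ => _) = (fun y => 'D_(delta_mx j 0) f y)); last first.
  by apply/funext => y; rewrite mxE.
by apply: continuous_borel_measurable; exact: (AS1_C1 hAS1).2.
Qed.

Lemma noise_adapted B k i j :
  adapted B (x k : Omega -> borel 'cV[R]_n) ->
  adapted B (xi k i : Omega -> borel 'cV[R]_d) ->
  adapted B (fun w => noise k i w j 0).
Proof.
move=> ax axi.
rewrite (_ : (fun _ => _) = (fun w => g (x k w) (xi k i w) j 0 -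
    gradient f (x k w) j 0)); last by apply/funext => w; rewrite !mxE.
apply: measurable_funB; first exact: oracle_adapted.
exact: (measurableT_comp (measurable_gradient_coord j) ax).
Qed.

(** * Independence of a new sample from the past, and moments of the noise *)

Lemma measurable_sample k i : sample_index m (k, i) ->
  measurable_fun setT (xi k i : Omega -> borel 'cV[R]_d).
Proof. by move/(samples_measurable hg). Qed.

Lemma past_sample_sub k : past_sample_index m k `<=` sample_index m.
Proof. by move=> ki []. Qed.

Lemma measurable_iterate k : (1 <= k)%N ->
  measurable_fun setT (x k : Omega -> borel 'cV[R]_n).
Proof.
move=> k1; apply: (adapted_measurable (@past_sample_sub k)).
exact: iterate_adapted.
Qed.

(** Used with [E] the past, and with [E] the past enlarged by another sample of the same batch. *)
Lemma sample_independent E k i d' (T : measurableType d') (X : Omega -> T) :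
  E `<=` sample_index m -> sample_index m (k, i) -> ~ E (k, i) ->
  adapted (history E) X ->
  independent P (sigma_of X) (sigma_of (xi k i : Omega -> borel 'cV[R]_d)).
Proof.
move=> Em mki Eki /adaptedP aX A B XA; apply: (independent_family_l (j := (k, i))
  (X := fun ki => xi ki.1 ki.2 : Omega -> borel 'cV[R]_d) _
  (AS2_samples_indep hAS2) Em mki Eki); last exact: aX.
by move=> ki /(samples_measurable hg).
Qed.

(** The noise as a deterministic map of iterate and sample, so that one can be frozen and the other
    integrated out. *)
Let noise_fun (z : (borel 'cV[R]_n * borel 'cV[R]_d)%type) : 'cV[R]_n :=
  g z.1 z.2 - gradient f z.1.

Let measurable_noise_fun j : measurable_fun setT (fun z => noise_fun z j 0).
Proof.
rewrite (_ : (fun _ => _) = (fun z => g z.1 z.2 j 0 - gradient f z.1 j 0));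
  last by apply/funext => z; rewrite !mxE.
apply: measurable_funB.
  exact: (measurableT_comp (measurable_coord j 0) (oracle_measurable hg)).
exact: (measurableT_comp (measurable_gradient_coord j) measurable_fst).
Qed.

Lemma noise_variance k i : sample_index m (k, i) ->
  (\int[P]_w (enorm (noise k i w) ^+ 2)%:E <= (sigma ^+ 2)%:E)%E.
Proof.
move=> mki; have k1 : (1 <= k)%N by case: mki.
have mx := measurable_iterate k1; have mxi := measurable_sample mki.
pose psi z := (enorm (noise_fun z) ^+ 2)%:E.
have mpsi : measurable_fun setT psi.
  exact/measurable_EFinP/measurable_enorm2.
have psi0 z : (0 <= psi z)%E by rewrite lee_fin sqr_ge0.
rewrite (ge0_integral_independent (psi := psi) mx mxi)//; last first.
  apply: (sample_independent (@past_sample_sub k)) => //.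
    by case=> _ /=; rewrite ltnn.
  exact: iterate_adapted.
apply: (@le_trans _ _ (\int[P]_w (cst (sigma ^+ 2)%:E) w)%E).
  apply: ae_ge0_le_integral => //.
  - by move=> w _; exact: integral_ge0.
  - exact: measurable_partial_expectation.
  - by move=> w _; rewrite lee_fin sqr_ge0.
  have := AS2_variance hAS2 mki; apply: filterS => w + _.
  by rewrite expectationE.
by rewrite integral_cst//= probability_setT mule1.
Qed.

Lemma noise_square_integrable k i j : sample_index m (k, i) ->
  square_integrable P (fun w => noise k i w j 0).
Proof.
move=> mki; have k1 : (1 <= k)%N by case: mki.
have mn l : measurable_fun setT (fun w => noise k i w l 0).
  apply: (measurableT_comp (measurable_noise_fun l)
    (measurable_fun_pair (measurable_iterate k1) (measurable_sample mki))).
split => //; apply: le_lt_trans (ltry (sigma ^+ 2)).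
apply: le_trans (noise_variance mki); apply: ge0_le_integral => //.
- by move=> w _; rewrite lee_fin sqr_ge0.
- exact/measurable_EFinP/measurable_funX.
- exact/measurable_EFinP/measurable_enorm2.
- by move=> w _; rewrite lee_fin sqr_coord_le_enorm2.
Qed.

(** The pair [(x k, u)] is determined by the samples in [E], hence independent of the new sample;
    with the pair frozen, the noise has mean zero. In the uses, [u] is an entry of the drift or of
    the noise of another sample of the batch. *)
Lemma centered_adapted_noise E k i j (u : Omega -> R) :
  E `<=` sample_index m -> past_sample_index m k `<=` E ->
  sample_index m (k, i) -> ~ E (k, i) ->
  adapted (history E) u -> square_integrable P u ->
  centered P (fun w => u w * noise k i w j 0).
Proof.
move=> Em kE mki Eki au u2; have k1 : (1 <= k)%N by case: mki.
have ax := iterate_adapted k1 kE.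
pose X w : (borel 'cV[R]_n * R)%type := (x k w, u w).
have aX : adapted (history E) X by exact: measurable_fun_pair.
have mX : measurable_fun setT X by exact: adapted_measurable aX.
have mxi := measurable_sample mki.
pose h (z : (borel 'cV[R]_n * R) * borel 'cV[R]_d) := noise_fun (z.1.1, z.2) j 0.
have mh : measurable_fun setT h.
  apply: (measurableT_comp (measurable_noise_fun j)).
  apply: measurable_fun_pair => //.
  exact: measurableT_comp.
rewrite (_ : (fun w => _) = (fun w => (X w).2 * h (X w, xi k i w)))//.
apply: (centered_independent_prod mX mxi) => //.
- exact: sample_independent aX.
- exact: noise_square_integrable.
have := AS2_unbiased hAS2 mki; have := AS2_variance hAS2 mki.
apply: filterS2 => w; rewrite expectationE => var /(_ j).
rewrite expectationE => mean.
have mn l : measurable_fun setT (fun w' => noise_fun (x k w, xi k i w') l 0).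
  exact: (measurableT_comp (measurable_noise_fun l)
    (measurable_fun_pair (measurable_cst _) mxi)).
have n2 : square_integrable P (fun w' => noise_fun (x k w, xi k i w') j 0).
  split => //; apply: le_lt_trans (ltry (sigma ^+ 2)).
  apply: le_trans var; apply: ge0_le_integral => //.
  - by move=> w' _; rewrite lee_fin sqr_ge0.
  - exact/measurable_EFinP/measurable_funX.
  - exact/measurable_EFinP/measurable_enorm2.
  - by move=> w' _; rewrite lee_fin sqr_coord_le_enorm2.
have one2 : square_integrable P (cst 1).
  split => //; under eq_integral do rewrite expr1n.
  by rewrite integral_cst//= probability_setT mule1 ltry.
have n1 : P.-integrable setT (fun w' => (h (X w, xi k i w'))%:E).
  apply: eq_integrable (square_integrable_prod n2 one2) => // w' _.
  by rewrite mulr1.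
split; first exact: n1.
have ic : P.-integrable setT (EFin \o cst (gradient f (x k w) j 0)).
  exact: finite_measure_integrable_cst.
(* Unbiasedness concerns [g], which is noise plus a constant; since both sides have the same finite
   mean, the constant cancels. *)
have := integralD_EFin measurableT n1 ic.
rewrite (eq_integral (fun w' => (g (x k w) (xi k i w') j 0)%:E)); last first.
  move=> w' _; congr (_%:E).
  by rewrite /h /noise_fun/= [X in X + _]mxE [X in _ + X + _]mxE subrK.
have := expectation_cst P (gradient f (x k w) j 0).
rewrite expectationE mean => -> Eg.
have := addeK (\int[P]_w' (h (X w, xi k i w'))%:E)%E
  (isT : (gradient f (x k w) j 0)%:E \is a fin_num).
by rewrite -[X in (X - _)%E]Eg subee.
Qed.

(** * Descent in mean and telescoping *)

(** Subtracting [flow] makes the integrand nonnegative, so the extended integral can be handled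
    before it is known to be finite. *)
Definition mean_gap k : \bar R := (\int[P]_w (f (x k w) - flow)%:E)%E.

Definition mean_grad2 k : \bar R :=
  (\int[P]_w (enorm (gradient f (x k w)) ^+ 2)%:E)%E.

Let f_diff y : differentiable f y.
Proof. exact: (AS1_C1 hAS1).1. Qed.

Let L_gt0 : 0 < L.
Proof. exact: AS1_L_gt0 hAS1. Qed.

Lemma measurable_objective k : (1 <= k)%N ->
  measurable_fun setT (fun w => f (x k w) - flow).
Proof.
move=> k1; apply: measurable_funB; last exact: measurable_cst.
apply: (measurableT_comp _ (measurable_iterate k1)).
apply: continuous_borel_measurable => y; exact: differentiable_continuous.
Qed.

Lemma gradient_adapted E k j : (1 <= k)%N -> past_sample_index m k `<=` E ->
  adapted (history E) (fun w => gradient f (x k w) j 0).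
Proof.
move=> k1 kE.
exact: (measurableT_comp (measurable_gradient_coord j) (iterate_adapted k1 kE)).
Qed.

Lemma measurable_grad2 k : (1 <= k)%N ->
  measurable_fun setT (fun w => enorm (gradient f (x k w)) ^+ 2).
Proof.
move=> k1; apply: measurable_enorm2 => j.
apply: (adapted_measurable (@past_sample_sub k)); exact: gradient_adapted.
Qed.

Lemma gap_ge0 k w : 0 <= f (x k w) - flow.
Proof. by rewrite subr_ge0 (AS1_lower hAS1). Qed.

Lemma mean_grad2_lty k : (1 <= k)%N -> (mean_gap k < +oo)%E ->
  (mean_grad2 k < +oo)%E.
Proof.
move=> k1 gap_fin.
apply: (@le_lt_trans _ _ ((2 * L)%:E * mean_gap k)%E); last first.
  by rewrite lte_mul_pinfty// ?lee_fin ?mulr_ge0 ?ltW.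
rewrite /mean_gap -ge0_integralZl_EFin//; last 3 first.
- by move=> w _; rewrite lee_fin gap_ge0.
- exact/measurable_EFinP/measurable_objective.
- by rewrite mulr_ge0 ?ltW.
apply: ge0_le_integral => //.
- by move=> w _; rewrite lee_fin sqr_ge0.
- exact/measurable_EFinP/measurable_grad2.
- apply/measurable_EFinP/measurable_funM => //; exact: measurable_objective.
move=> w _; rewrite -EFinM lee_fin.
apply: enorm2_gradient_le => //; first exact: AS1_lipschitz hAS1.
exact: AS1_lower hAS1.
Qed.

(** The vector paired with the noise in [quasi_newton_descent]. *)
Definition drift (a : R) k w : 'cV[R]_n :=
  (2 * a) *: gradient f (x k w)
  - alpha k *: (H k w *m gradient f (x k w)).

Lemma drift_adapted a E k j : (1 <= k)%N -> past_sample_index m k `<=` E ->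
  adapted (history E) (fun w => drift a k w j 0).
Proof.
move=> k1 kE.
rewrite (_ : (fun _ => _) = (fun w => 2 * a * gradient f (x k w) j 0
    - alpha k * \sum_l (H k w j l * gradient f (x k w) l 0))); last first.
  apply/funext => w; rewrite /drift; set G := gradient f (x k w).
  by rewrite !mxE.
have aG l := gradient_adapted l k1 kE.
apply: measurable_funB.
  apply: measurable_funM; [exact: measurable_cst|exact: aG].
apply: measurable_funM; first exact: measurable_cst.
apply: measurable_sum => l.
apply: measurable_funM; last exact: aG.
exact: (measurableT_comp (measurable_coord j l) (qn_matrix_adapted k1 kE)).
Qed.

Lemma qn_matrix_symmetric k : (1 <= k)%N -> {ae P, forall w, (H k w)^T = H k w}.
Proof. by move=> k1; apply: filterS (sqn_H_pd hSQN k1) => w []. Qed.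

Lemma drift_square_integrable a k j : (1 <= k)%N -> (mean_gap k < +oo)%E ->
  square_integrable P (fun w => drift a k w j 0).
Proof.
move=> k1 gap_fin.
have md : measurable_fun setT (fun w => drift a k w j 0).
  by apply: (adapted_measurable (@past_sample_sub k)); exact: drift_adapted.
split => //.
(* From [|u - v|^2 <= 2 (|u|^2 + |v|^2)] and the bound [ku] on [H k]. *)
pose K := 2 * ((2 * a) ^+ 2 + alpha k ^+ 2 * ku ^+ 2).
have K0 : 0 <= K by rewrite mulr_ge0// addr_ge0 ?sqr_ge0// mulr_ge0 ?sqr_ge0.
apply: (@le_lt_trans _ _ (K%:E * mean_grad2 k)%E); last first.
  by rewrite lte_mul_pinfty// mean_grad2_lty.
rewrite /mean_grad2 -ge0_integralZl_EFin//; last 2 first.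
- by move=> w _; rewrite lee_fin sqr_ge0.
- exact/measurable_EFinP/measurable_grad2.
apply: ae_le_integral_ge0.
- exact/measurable_EFinP/measurable_funX.
- by move=> w; rewrite lee_fin sqr_ge0.
- apply/measurable_EFinP/measurable_funM => //; exact: measurable_grad2.
apply: filterS (AS3_bounds hAS3 k1) => w [lH uH].
rewrite -EFinM lee_fin (le_trans (sqr_coord_le_enorm2 _ _))//.
rewrite /drift; set G := gradient f (x k w).
have := loewner_enorm_le G (ltW (AS3_kl_gt0 hAS3)) (ltW (AS3_ku_gt0 hAS3)) lH uH.
move/(ler_wpM2l (sqr_ge0 (alpha k))).
have := sqr_ge0 (enorm ((2 * a) *: G + alpha k *: (H k w *m G))).
rewrite -scaleNr !enorm2D !enorm2Z sqrrN !dotvZr /K; lra.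
Qed.

Lemma batch_gradientE k w : (1 <= k)%N ->
  batch_gradient g m xi x k w =
  gradient f (x k w) + (m k)%:R^-1 *: \sum_(i < m k) noise k i w.
Proof.
move=> k1; rewrite /batch_gradient /noise big_split/= sumrN sumr_const card_ord.
rewrite scalerBr -[gradient f _ *+ _]scaler_nat scalerA mulVf.
  by rewrite scale1r addrC subrK.
by rewrite pnatr_eq0 -lt0n (sqn_batch_ge1 hSQN).
Qed.

(* The terms of the one-step estimate that average out: the drift against the
   noise of the batch, and the products of the noises of distinct samples. *)
Let cross a k w : R :=
  (m k)%:R^-1 * (\sum_l \sum_(i < m k) drift a k w l 0 * noise k i w l 0) +
  a * ((m k)%:R^-1 ^+ 2 *
    (\sum_l \sum_(i < m k) \sum_(j < m k | j != i)
      noise k i w l 0 * noise k j w l 0)).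

Let batch_noise2 k w : R := \sum_(i < m k) enorm (noise k i w) ^+ 2.

(** Each summand is an adapted factor times the noise of a sample outside the corresponding index
    set. *)
Let centered_cross a k : (1 <= k)%N -> (mean_gap k < +oo)%E ->
  centered P (cross a k).
Proof.
move=> k1 gap_fin; apply: centeredD; apply: centeredZ.
  apply: centered_sum => l _; apply: centered_sum => i _.
  apply: (@centered_adapted_noise _ k i l (fun w => drift a k w l 0)
    (@past_sample_sub k)) => //.
  - by split => //=; exact: ltn_ord.
  - by case=> _ /=; rewrite ltnn.
  - exact: drift_adapted.
  - exact: drift_square_integrable.
apply: centeredZ; apply: centered_sum => l _; apply: centered_sum => i _.
apply: centered_sum => j ji.
(* Adding sample [i] to the past makes its noise adapted, while sample [j] stays outside as
   [j != i]. *)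
pose E := past_sample_index m k `|` [set (k, nat_of_ord i)].
have Em : E `<=` sample_index m.
  by move=> ki [[]//|->]; split => //=; exact: ltn_ord.
have kE : past_sample_index m k `<=` E by move=> ki; left.
apply: (@centered_adapted_noise E k j l (fun w => noise k i w l 0) Em kE).
- by split => //=; exact: ltn_ord.
- case=> [[_ /=]|[ij]]; first by rewrite ltnn.
  by move/eqP : ji; apply; apply: val_inj.
- apply: noise_adapted; first exact: iterate_adapted.
  by apply: sample_adapted; right.
- by apply: noise_square_integrable; split => //=; exact: ltn_ord.
Qed.

Let step_bound a k : (1 <= k)%N -> 0 <= a ->
  a = alpha k ^+ 2 * L * ku ^+ 2 / 2 ->
  {ae P, forall w,
    f (x k.+1 w) - flow + (alpha k * kl - a) * enorm (gradient f (x k w)) ^+ 2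
    <= f (x k w) - flow + cross a k w
       + a * (m k)%:R^-1 ^+ 2 * batch_noise2 k w}.
Proof.
move=> k1 a0 aE.
apply: filterS2 (AS3_bounds hAS3 k1) (qn_matrix_symmetric k1) => w [lH uH] sH.
have := quasi_newton_descent (x k w)
  ((m k)%:R^-1 *: \sum_(i < m k) noise k i w) (ltW L_gt0)
  (ltW (AS3_kl_gt0 hAS3)) (ltW (AS3_ku_gt0 hAS3)) (ltW (sqn_step_gt0 hSQN k1))
  f_diff (AS1_lipschitz hAS1) sH lH uH aE.
rewrite -batch_gradientE// -(sqn_x_step hSQN)// -/(drift a k w).
rewrite enorm2Z enorm2_sum dotvZr.
have -> : dotv (drift a k w) (\sum_(i < m k) noise k i w) =
    \sum_l \sum_(i < m k) drift a k w l 0 * noise k i w l 0.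
  by apply: eq_bigr => l _; rewrite summxE mulr_sumr.
rewrite /cross /batch_noise2; lra.
Qed.

(** Integrating [step_bound], the cross terms vanish and the [m k] diagonal terms, of mean at most
    [sigma^2] each and weighted by [(m k)^-2], give [sigma^2 / m k]. Finiteness of the current gap
    makes the drift square integrable. *)
Lemma mean_descent k : (1 <= k)%N ->
  0 <= alpha k * kl - alpha k ^+ 2 * L * ku ^+ 2 / 2 ->
  (mean_gap k < +oo)%E ->
  (mean_gap k.+1
    + (alpha k * kl - alpha k ^+ 2 * L * ku ^+ 2 / 2)%:E * mean_grad2 k <=
   mean_gap k + (alpha k ^+ 2 * L * ku ^+ 2 / 2 * (sigma ^+ 2 / (m k)%:R))%:E)%E.
Proof.
move=> k1; set a := alpha k ^+ 2 * L * ku ^+ 2 / 2; set c := _ - a => c0 gap_fin.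
have a0 : 0 <= a.
  by rewrite divr_ge0// mulr_ge0 ?sqr_ge0// mulr_ge0 ?sqr_ge0// ltW.
have m0 : (0 : R) < (m k)%:R by rewrite ltr0n (sqn_batch_ge1 hSQN).
set b := a * (m k)%:R^-1 ^+ 2.
have b0 : 0 <= b by rewrite mulr_ge0 ?sqr_ge0.
have [icross cross0] := centered_cross a k1 gap_fin.
have mgap := measurable_objective k1.
have igap : P.-integrable setT (EFin \o (fun w => f (x k w) - flow)).
  apply/integrableP; split; first exact/measurable_EFinP.
  by under eq_integral do rewrite gee0_abs ?lee_fin ?gap_ge0//.
have mki (i : 'I_(m k)) : sample_index m (k, nat_of_ord i).
  by split => //=; exact: ltn_ord.
have mn (i : 'I_(m k)) :
    measurable_fun setT (fun w => enorm (noise k i w) ^+ 2).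
  by apply: measurable_enorm2 => l; case: (noise_square_integrable l (mki i)).
have mQ : measurable_fun setT (batch_noise2 k) by exact: measurable_sum.
have Q0 w : 0 <= batch_noise2 k w by apply: sumr_ge0 => i _; exact: sqr_ge0.
have Qs : (\int[P]_w (batch_noise2 k w)%:E <= ((m k)%:R * sigma ^+ 2)%:E)%E.
  under eq_integral do rewrite /batch_noise2 -sumEFin.
  rewrite ge0_integral_sum//; last 2 first.
  - by move=> i; exact/measurable_EFinP.
  - by move=> i w _; rewrite lee_fin sqr_ge0.
  apply: (@le_trans _ _ (\sum_(i < m k) (sigma ^+ 2)%:E)%E).
    by apply: lee_sum => i _; exact: noise_variance.
  by rewrite sumEFin sumr_const card_ord mulr_natl.
have ibQ : P.-integrable setT (EFin \o (fun w => b * batch_noise2 k w)).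
  apply: (integrableZl measurableT b (f := EFin \o batch_noise2 k)).
  apply/integrableP; split; first exact/measurable_EFinP.
  under eq_integral do rewrite gee0_abs ?lee_fin ?Q0//.
  exact: le_lt_trans Qs (ltry _).
have mG := measurable_grad2 k1.
(* As [c] is nonnegative, so are both integrands, and their integrals add up before the next gap is
   known to be finite. *)
have -> : (mean_gap k.+1 + c%:E * mean_grad2 k = \int[P]_w
    (f (x k.+1 w) - flow + c * enorm (gradient f (x k w)) ^+ 2)%:E)%E.
  under eq_integral do rewrite EFinD EFinM.
  rewrite ge0_integralD//; last 4 first.
  - by move=> w _; rewrite lee_fin gap_ge0.
  - exact/measurable_EFinP/measurable_objective.
  - by move=> w _; rewrite -EFinM lee_fin mulr_ge0 ?sqr_ge0.
  - by apply/measurable_EFinP/measurable_funM.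
  rewrite ge0_integralZl_EFin//; first by move=> w _; rewrite lee_fin sqr_ge0.
  exact/measurable_EFinP.
apply: (@le_trans _ _ (\int[P]_w
    (f (x k w) - flow + cross a k w + b * batch_noise2 k w)%:E)%E).
  apply: ae_le_integral_ge0.
  - apply/measurable_EFinP/measurable_funD; first exact: measurable_objective.
    exact: measurable_funM.
  - by move=> w; rewrite lee_fin addr_ge0 ?gap_ge0// mulr_ge0 ?sqr_ge0.
  - exact: measurable_int
      (integrableD measurableT (integrableD measurableT igap icross) ibQ).
  by apply: filterS (step_bound k1 a0 erefl) => w; rewrite lee_fin.
under eq_integral do rewrite EFinD.
rewrite integralD//; last exact: (integrableD measurableT igap icross).
under eq_integral do rewrite EFinD.
rewrite integralD// cross0 adde0 leeD2l//.
under eq_integral do rewrite EFinM.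
rewrite ge0_integralZl_EFin//; last 2 first.
- by move=> w _; rewrite lee_fin.
- exact/measurable_EFinP.
apply: (le_trans (lee_wpmul2l _ Qs)); first by rewrite lee_fin.
rewrite -EFinM lee_fin le_eqVlt; apply/orP; left; apply/eqP.
by rewrite /b; field; rewrite gt_eqF.
Qed.

(** The induction keeps the current gap on the left: its bound also shows that gap finite, which is
    what the next step requires. *)
Lemma sum_mean_grad2_le (N : nat) (c b : R) : 0 <= c ->
  (forall k, (1 <= k <= N)%N -> (mean_gap k < +oo)%E ->
    (mean_gap k.+1 + c%:E * mean_grad2 k <= mean_gap k + b%:E)%E) ->
  (c%:E * \sum_(1 <= k < N.+1) mean_grad2 k <= (f x1 - flow + N%:R * b)%:E)%E.
Proof.
move=> c0 step.
have q0 k : (0 <= mean_grad2 k)%E.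
  by apply: integral_ge0 => w _; rewrite lee_fin sqr_ge0.
have gap0 k : (0 <= mean_gap k)%E.
  by apply: integral_ge0 => w _; rewrite lee_fin gap_ge0.
have T0 j : (0 <= c%:E * \sum_(1 <= k < j) mean_grad2 k)%E.
  by rewrite mule_ge0 ?lee_fin ?sume_ge0.
suff key j : (j <= N)%N -> (mean_gap j.+1 +
    c%:E * \sum_(1 <= k < j.+1) mean_grad2 k <=
    (f x1 - flow + j%:R * b)%:E)%E.
  by apply: le_trans (key N (leqnn _)); rewrite leeDr.
elim: j => [_|j IH jN].
  rewrite big_geq// mule0 adde0 mul0r addr0 /mean_gap.
  under eq_integral do rewrite (sqn_x_init hSQN).
  by rewrite -[X in (X <= _)%E]expectationE (expectation_cst P (f x1 - flow)).
have {}IH := IH (ltnW jN).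
have gap_fin : (mean_gap j.+1 < +oo)%E.
  by apply: le_lt_trans (ltry _); apply: le_trans IH; rewrite leeDl.
have := step j.+1; rewrite ltn0Sn jN => /(_ isT gap_fin) {}step.
rewrite big_nat_recr//= ge0_muleDr ?sume_ge0// addeCA.
apply: le_trans (leeD2l _ step) _.
rewrite addeA [X in (X + _)%E]addeC.
apply: le_trans (leeD2r _ IH) _.
by rewrite -EFinD lee_fin -natr1; lra.
Qed.

(** * The randomly chosen iterate *)

(** The event [tau w = k] is independent of [x k], so each [k] contributes a product. Off the range
    [1, ..., N] the integrand is not controlled, [x 0] being arbitrary, but that event is null
    because the [p k] add up to 1. *)
Lemma random_iterate_mean (N : nat) (tau : Omega -> nat) (p : nat -> R) :
  measurable_fun setT tau ->
  independent P (sigma_of tau) <<s history (sample_index m) >> ->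
  (forall k, (1 <= k <= N)%N -> P [set w | tau w = k] = (p k)%:E) ->
  \sum_(1 <= k < N.+1) p k = 1 ->
  (\int[P]_w (enorm (gradient f (x (tau w) w)) ^+ 2)%:E <=
   \sum_(1 <= k < N.+1) (p k)%:E * mean_grad2 k)%E.
Proof.
move=> mtau itau pE p1.
have mtauE A : measurable (tau @^-1` A).
  by rewrite -[X in measurable X]setTI; exact: mtau.
pose I w := (1 <= tau w <= N)%N.
pose h k w := (tau w == k)%:R * enorm (gradient f (x k w)) ^+ 2.
have h0 k w : (0 <= (h k w)%:E)%E by rewrite lee_fin mulr_ge0 ?sqr_ge0.
have mh k : (1 <= k)%N -> measurable_fun setT (fun w => (h k w)%:E).
  move=> k1; apply/measurable_EFinP/measurable_funM;
    last exact: measurable_grad2.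
  exact: (measurableT_comp (f := fun t : nat => (t == k)%:R : R)).
have inth k : (1 <= k <= N)%N ->
    (\int[P]_w (h k w)%:E = (p k)%:E * mean_grad2 k)%E.
  move=> /[dup] kN /andP[k1 _].
  pose psi (z : (borel 'cV[R]_n * nat)%type) :=
    ((z.2 == k)%:R * enorm (gradient f z.1) ^+ 2)%:E.
  have psi0 z : (0 <= psi z)%E by rewrite lee_fin mulr_ge0 ?sqr_ge0.
  have mpsi : measurable_fun setT psi.
    apply/measurable_EFinP/measurable_funM.
      exact: (measurableT_comp (f := fun t : nat => (t == k)%:R : R)).
    apply: measurable_enorm2 => j.
    exact: (measurableT_comp (measurable_gradient_coord j) measurable_fst).
  rewrite (ge0_integral_independent (psi := psi) (measurable_iterate k1) mtau)//;
    last first.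
    move=> A B XA tB; rewrite setIC muleC; apply: itau => //.
    have /adaptedP := iterate_adapted k1 (@past_sample_sub k).
    exact.
  rewrite -ge0_integralZl//; last 3 first.
  - exact/measurable_EFinP/measurable_grad2.
  - by move=> w _; rewrite lee_fin sqr_ge0.
  - by rewrite -pE.
  apply: eq_integral => w _; rewrite /psi/=.
  under eq_integral do rewrite EFinM.
  rewrite ge0_integralZr//; last 2 first.
  - apply/measurable_EFinP.
    exact: (measurableT_comp (f := fun t : nat => (t == k)%:R : R)).
  - by rewrite lee_fin sqr_ge0.
  congr (_ * _)%E; rewrite -pE// -[X in P X]setIT -integral_indic//; last first.
    exact: (mtauE [set k]).
  apply: eq_integral => w' _; rewrite indicE.
  suff -> : (w' \in [set w | tau w = k]) = (tau w' == k) by [].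
  by apply/idP/eqP => [/set_mem|tk] //; exact: mem_set.
pose S w := (\sum_(i < N) (h i.+1 w)%:E)%E.
have S0 w : (0 <= S w)%E by exact: sume_ge0.
have mS : measurable_fun setT S by apply: emeasurable_sum => i; exact: mh.
(* A measurable majorant, infinite off the range; this costs nothing once the range is shown to have
   probability 1. *)
pose F w : \bar R := if I w then S w else +oo%E.
have mF : measurable_fun setT F.
  apply: measurable_fun_ifT => //.
  exact: (measurableT_comp (f := fun t : nat => (1 <= t <= N)%N)).
apply: (@le_trans _ _ (\int[P]_w F w)%E).
  apply: ge0_le_integralT => w; first by rewrite lee_fin sqr_ge0.
  rewrite /F; case: ifPn => [/andP[t1 tN]|_]; last exact: leey.
  (* The summand [i] of [S] belongs to iteration [i.+1]. *)
  have tN' : ((tau w).-1 < N)%N by rewrite prednK.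
  rewrite /S (bigD1 (Ordinal tN'))//= prednK//.
  by rewrite {1}/h eqxx mul1r leeDl// sume_ge0.
have PI : P [set w | I w] = 1%E.
  rewrite (_ : mkset _ = \big[setU/set0]_(i < N) [set w | tau w = i.+1]).
    rewrite (measure_bigsetU P (F := fun i => [set w | tau w = i.+1]))//;
      last 2 first.
    - by move=> i; exact: (mtauE [set i.+1]).
    - apply/trivIsetP => i j _ _ /eqP ij; apply/seteqP; split => // w [/= ->].
      by case.
    rewrite -p1 big_add1/= big_mkord -sumEFin; apply: eq_bigr => i _.
    by rewrite pE//=.
  rewrite -(bigcup_mkord N (fun i => [set w | tau w = i.+1])).
  apply/seteqP; split => w /=.
    move=> /andP[t1 tN]; exists (tau w).-1; rewrite /= prednK//.
  by move=> [i /= iN tw]; rewrite /I tw.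
have FS : {ae P, forall w, setT w -> F w = S w}.
  exists (~` [set w | I w]); split.
  - exact: (mtauE [set t | ~ (1 <= t <= N)%N]).
  - rewrite probability_setC ?PI ?subee//.
    exact: (mtauE [set t | (1 <= t <= N)%N]).
  - by move=> w /= + Iw; apply => _; rewrite /F Iw.
rewrite (ge0_ae_eq_integral _ mF mS _ _ FS)//; last first.
  by move=> w _; rewrite /F; case: ifP => // _; exact: leey.
rewrite /S ge0_integral_sum//; last by move=> i; exact: mh.
rewrite big_add1/= big_mkord le_eqVlt; apply/orP; left; apply/eqP.
by apply: eq_bigr => i _; rewrite inth//=.
Qed.

End StochasticQuasiNewton.

(** * The numerical choice of batch size and number of iterations *)

Section Complexity.
Context {R : realType}.
Implicit Types (sigma L kl ku Df Dt eps y : R).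

Lemma absz_ceil_bounds y : 0 <= y ->
  y <= (`|Num.ceil y|%N)%:R < y + 1.
Proof.
move=> y0; rewrite natr_absz ger0_norm ?ceil_ge0//; last first.
  by apply: lt_le_trans y0; rewrite ltrN10.
have /andP[+ ->] := ceil_itv y.
by rewrite intrB ltrBlDr.
Qed.

(** With [q = Nbar], the batch size satisfies [s <= M <= 1 + s] and [N >= q / M], so the two terms
    are at most [K (1 + s) / q] and [sigma^2 / s]. Their sum is [(K + A r) / r^2], and the first
    lower bound on [Nbar] makes this at most [eps]. *)
Lemma sqn_complexity sigma L kl ku Df Dt eps (Nbar : nat) :
  let M := batch_size sigma L Dt Nbar in
  let N := num_iterations (R := R) Nbar M in
  0 < sigma -> 0 < L -> 0 < kl -> 0 < ku -> 0 <= Df -> 0 < Dt -> 0 < eps ->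
  Num.max (C1 sigma L kl ku Df Dt ^+ 2 / eps ^+ 2
           + 4 * C2 L kl ku Df / eps)
        (sigma ^+ 2 / (L ^+ 2 * Dt)) <= Nbar%:R ->
  [/\ (0 < M)%N, (0 < N)%N &
    2 * L * ku ^+ 2 * Df / (kl ^+ 2 * N%:R) + sigma ^+ 2 / M%:R <= eps].
Proof.
move=> M N s0 L0 kl0 ku0 D0 Dt0 eps0; rewrite ge_max => /andP[h1 h2].
set q := Nbar%:R : R; pose r := Num.sqrt q; pose e := Num.sqrt Dt.
have e0 : 0 < e by rewrite sqrtr_gt0.
have q0 : 0 < q by apply: lt_le_trans h2; rewrite divr_gt0 ?mulr_gt0 ?exprn_gt0.
have r0 : 0 < r by rewrite sqrtr_gt0.
have rq : r ^+ 2 = q by rewrite sqr_sqrtr ?ltW.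
have eD : e ^+ 2 = Dt by rewrite sqr_sqrtr ?ltW.
pose s := sigma / L * (r / e).
have s_gt0 : 0 < s by rewrite mulr_gt0 ?divr_gt0.
have sE : sigma / L * Num.sqrt (q / Dt) = s.
  by rewrite sqrtrM ?ltW// sqrtrV ?ltW.
(* The second lower bound on [Nbar] says [sigma / (L e) <= r]; hence the minimum in [batch_size] is
   attained by the maximum. *)
have sq : s <= q.
  rewrite /s -rq (_ : _ * _ = sigma / (L * e) * r); last by field; rewrite !gt_eqF.
  have d0 : 0 < sigma / (L * e) by rewrite divr_gt0 ?mulr_gt0.
  rewrite expr2 ler_pM2r// -(ler_pXn2r (n := 2)) ?nnegrE ?(ltW d0) ?(ltW r0)//.
  by rewrite rq exprMn exprVn exprMn eD.
have q1 : 1 <= q by rewrite /q ler1n; move: q0; rewrite /q ltr0n.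
have ME : M = `|Num.ceil (Num.max 1 s)%R|%N.
  rewrite /M /batch_size sE; congr (absz (Num.ceil _)).
  by apply/min_idPr; rewrite ge_max q1 sq.
have max0 : 0 <= Num.max 1 s by rewrite le_max ler01.
have [Mge Mlt] := andP (absz_ceil_bounds max0).
rewrite -ME in Mge Mlt.
have M1 : 1 <= M%:R :> R by apply: le_trans Mge; rewrite le_max lexx.
have Ms : s <= M%:R by apply: le_trans Mge; rewrite le_max lexx orbT.
have M0 : (0 < M)%N by rewrite -(ltr0n R); exact: lt_le_trans M1.
have Mp : (0 : R) < M%:R by rewrite ltr0n.
(* For [s <= 1] the ceiling is exactly 1; otherwise it is less than [s + 1]. *)
have M1s : M%:R <= 1 + s.
  have [s1|s1] := leP s 1.
    by rewrite ME (max_idPl s1) ceil1/= lerDl ltW.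
  by move: Mlt; rewrite maxEle ltW//= addrC => /ltW.
have qM0 : 0 <= q / M%:R by rewrite divr_ge0 ?ltW.
have [Nge _] := andP (absz_ceil_bounds qM0).
rewrite -/(num_iterations (R := R) Nbar M) -/N in Nge.
have N0 : (0 : R) < N%:R by apply: lt_le_trans Nge; rewrite divr_gt0.
split => //; first by rewrite -(ltr0n R).
pose K := 2 * L * ku ^+ 2 * Df / kl ^+ 2.
have K0 : 0 <= K.
  by rewrite divr_ge0 ?sqr_ge0// mulr_ge0// mulr_ge0 ?sqr_ge0// mulr_ge0// ltW.
(* The coefficient of [1 / r] in the final bound; [C1] exceeds it by a second copy of
   [K sigma / (L e)]. *)
pose A := K * sigma / (L * e) + sigma * L * e.
have A1 : 0 <= K * sigma / (L * e).
  apply: divr_ge0; first by rewrite mulr_ge0// ltW.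
  by rewrite ltW// mulr_gt0.
have A0 : 0 <= A.
  by rewrite addr_ge0// ltW// !mulr_gt0.
have C1E : C1 sigma L kl ku Df Dt = A + K * sigma / (L * e).
  by rewrite /C1 /A /K -/e; field; rewrite !gt_eqF.
have C2E : C2 L kl ku Df = 2 * K by rewrite /C2 /K; field; rewrite gt_eqF.
have first_term : 2 * L * ku ^+ 2 * Df / (kl ^+ 2 * N%:R) <= K * (1 + s) / q.
  have -> : 2 * L * ku ^+ 2 * Df / (kl ^+ 2 * N%:R) = K * N%:R^-1.
    by rewrite /K; field; rewrite !gt_eqF.
  rewrite -mulrA ler_wpM2l// ler_pdivlMr// mulrC ler_pdivrMr//.
  move: Nge; rewrite ler_pdivrMr// => /le_trans; apply.
  by rewrite mulrC ler_pM2r.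
have second_term : sigma ^+ 2 / M%:R <= sigma * L * e / r.
  have -> : sigma * L * e / r = sigma ^+ 2 / s.
    by rewrite /s; field; rewrite !gt_eqF.
  by rewrite ler_wpM2l ?sqr_ge0// lef_pV2 ?posrE.
apply: le_trans (lerD first_term second_term) _.
have -> : K * (1 + s) / q + sigma * L * e / r = (K + A * r) / r ^+ 2.
  by rewrite -rq /s /A; field; rewrite !gt_eqF.
rewrite ler_pdivrMr ?exprn_gt0//.
have : (C1 sigma L kl ku Df Dt) ^+ 2 + 8 * K * eps <= (r * eps) ^+ 2.
  rewrite exprMn rq -ler_pdivrMr ?exprn_gt0//; apply: le_trans h1.
  rewrite C2E le_eqVlt; apply/orP; left; apply/eqP; field; rewrite gt_eqF//.
have AC : A ^+ 2 <= (C1 sigma L kl ku Df Dt) ^+ 2.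
  have AC : A <= C1 sigma L kl ku Df Dt by rewrite C1E lerDl.
  by rewrite ler_pXn2r ?nnegrE// (le_trans A0).
have Ke : 0 <= K * eps by rewrite mulr_ge0// ltW.
(* Hence [A r eps <= (A^2 + (r eps)^2) / 2], and [A^2 + 8 K eps <= (r eps)^2] leaves room for the
   extra [K eps]. *)
have := sqr_ge0 (A - r * eps).
move=> h3 h4; rewrite -(ler_pM2r eps0).
nra.
Qed.

End Complexity.

(** * Assembly with uniform weights *)

Theorem corollary2p5 (R : realType) (n d : nat)
    (disp : measure_display) (Omega : measurableType disp)
    (P : probability Omega R)
    (mu : probability (borel 'cV[R]_d) R) (Xi : set 'cV[R]_d)
    (F : 'cV[R]_n * 'cV[R]_d -> R) (f : 'cV[R]_n -> R)
    (g : 'cV[R]_n -> 'cV[R]_d -> 'cV[R]_n)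
    (x1 : 'cV[R]_n) (H1 : 'M[R]_n) (m : nat -> nat) (alpha : nat -> R)
    (xi : nat -> nat -> Omega -> 'cV[R]_d)
    (x : nat -> Omega -> 'cV[R]_n) (H : nat -> Omega -> 'M[R]_n)
    (flow L sigma kl ku Dt eps : R) (Nbar N : nat) (tau : Omega -> nat)
    (hF : expected_objective mu Xi F f)
    (hg : stochastic_oracle P Xi g m xi)
    (hSQN : sqn_iteration P x1 H1 alpha g m xi x H)
    (hAS1 : AS1 f flow L)
    (hAS2 : AS2 P f g m xi x sigma)
    (hAS3 : AS3 P H kl ku)
    (hAS4 : AS4 m xi H)
    (hDt : 0 < Dt) (heps : 0 < eps)
    (hNbar : Num.max
        (C1 sigma L kl ku (f x1 - flow) Dt ^+ 2 / eps ^+ 2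
           + 4 * C2 L kl ku (f x1 - flow) / eps)
        (sigma ^+ 2 / (L ^+ 2 * Dt)) <= Nbar%:R)
    (hm : forall k, (1 <= k)%N -> m k = batch_size sigma L Dt Nbar)
    (hN : N = num_iterations (R := R) Nbar (batch_size sigma L Dt Nbar))
    (halpha : forall k, (1 <= k <= N)%N -> alpha k = kl / (L * ku ^+ 2))
    (htau : measurable_fun setT tau)
    (htau_indep : independent P (sigma_of tau)
        (sigma_of_family (sample_index m)
           (fun ki => xi ki.1 ki.2 : Omega -> borel 'cV[R]_d)))
    (htau_pmf : forall k, (1 <= k <= N)%N ->
        P [set w | tau w = k] =
        (pmf_weight L kl ku alpha k
           / \sum_(1 <= j < N.+1) pmf_weight L kl ku alpha j)%:E) :
  ('E_P[fun w => (enorm (gradient f (x (tau w) w)) ^+ 2)%R] <= eps%:E)%E.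
Proof.
have [L0 s0] := (AS1_L_gt0 hAS1, AS2_sigma_gt0 hAS2).
have [kl0 ku0] := (AS3_kl_gt0 hAS3, AS3_ku_gt0 hAS3).
set M := batch_size sigma L Dt Nbar in hN hm.
pose D := f x1 - flow.
have D0 : 0 <= D by rewrite subr_ge0 (AS1_lower hAS1).
have [M0 N0 complexity] := sqn_complexity s0 L0 kl0 ku0 D0 hDt heps hNbar.
rewrite -/M -hN in M0 N0 complexity.
have Nn0 : (0 : R) < N%:R by rewrite ltr0n.
have Mn0 : (0 : R) < M%:R by rewrite ltr0n.
(* The prescribed step maximises [alpha kl - alpha^2 L ku^2 / 2]; there the subtracted term equals
   the difference, both being [c], and every index has probability [1 / N]. *)
pose c := kl ^+ 2 / (2 * L * ku ^+ 2).
have c0 : 0 < c by rewrite divr_gt0 ?exprn_gt0// mulr_gt0 ?exprn_gt0// mulr_gt0.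
have half k : (1 <= k <= N)%N -> alpha k ^+ 2 * L * ku ^+ 2 / 2 = c.
  by move=> kN; rewrite halpha// /c; field; rewrite !gt_eqF.
have weight k : (1 <= k <= N)%N ->
    alpha k * kl - alpha k ^+ 2 * L * ku ^+ 2 / 2 = c.
  by move=> kN; rewrite halpha// /c; field; rewrite !gt_eqF.
have sum_weight : \sum_(1 <= j < N.+1) pmf_weight L kl ku alpha j = N%:R * c.
  rewrite (eq_big_nat _ _ (F2 := fun=> c)); last exact: weight.
  by rewrite sumr_const_nat subn1 mulr_natl.
rewrite expectationE.
apply: (le_trans (random_iterate_mean hg hSQN hAS1 hAS4 (N := N)
  (p := fun=> N%:R^-1)
  htau htau_indep _ _)).
- move=> k kN; rewrite htau_pmf//.
  rewrite sum_weight (weight k kN : pmf_weight L kl ku alpha k = c).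
  by congr (_%:E); field; rewrite !gt_eqF.
- by rewrite sumr_const_nat subn1 -[LHS]mulr_natl mulfV ?gt_eqF.
have := sum_mean_grad2_le hSQN hAS1 (N := N)
  (b := c * (sigma ^+ 2 / M%:R)) (ltW c0).

have step k : (1 <= k <= N)%N -> (mean_gap P f x flow k < +oo)%E ->
    (mean_gap P f x flow k.+1 + c%:E * mean_grad2 P f x k <=
     mean_gap P f x flow k + (c * (sigma ^+ 2 / M%:R))%:E)%E.
  move=> /[dup] kN /andP[k1 _] gap_fin.
  have := mean_descent hg hSQN hAS1 hAS2 hAS3 hAS4 k1.
  rewrite weight// half// hm//; apply => //; exact: ltW.
move=> /(_ step) sum_le.
rewrite -ge0_sume_distrr; last first.
  by move=> k _; apply: integral_ge0 => w _; rewrite lee_fin sqr_ge0.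
(* Exposes the factor [c] of the telescoped bound; dividing that bound by [N c] gives the left-hand
   side of [complexity]. *)
have -> : (N%:R^-1)%:E = ((N%:R * c)^-1 * c)%:E :> \bar R.
  by congr (_%:E); field; rewrite !gt_eqF.
rewrite EFinM -muleA; apply: (le_trans (lee_wpmul2l _ sum_le)).
  by rewrite lee_fin invr_ge0 mulr_ge0 ?ltW.
rewrite -EFinM lee_fin; apply: le_trans complexity.
rewrite le_eqVlt; apply/orP; left; apply/eqP.
by rewrite /c /D; field; rewrite !gt_eqF.
Qed.
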